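(* Let $(A,\succ,\prec,\Delta_\succ,\Delta_\prec)$ be a Leibniz-dendriform bialgebra and let $(B=\bigoplus_{i\in\mathbb Z}B_i,\diamond,\omega)$ be a quadratic $\mathbb Z$-graded Zinbiel algebra. Let $\eta_\omega:B\to B\hat\otimes B$ be the linear map determined by $\hat\omega(\eta_\omega(b_1),b_2\otimes b_3)=-\omega(b_1,b_2\diamond b_3)$ for all $b_1,b_2,b_3\in B$. Define a binary operation $\cdot$ on $A\otimes B$ by $$(a\otimes x)\cdot(b\otimes y)=(a\succ b)\otimes (x\diamond y)-(b\prec a)\otimes (y\diamond x)$$ and a linear map $\delta:A\otimes B\to(A\otimes B)\hat\otimes(A\otimes B)$ by $$\delta(a\otimes x)=\Delta_\succ(a)\bullet\eta_\omega(x)-\tau\Delta_\prec(a)\bullet\hat\tau\eta_\omega(x),$$ for $a,b\in A$, $x,y\in B$. Then $(A\otimes B,\cdot,\delta)$ is a completed pre-Lie bialgebra.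
   Context: All vector spaces are over a field $\mathbb K$; $\tau$ is the flip, $I$ the identity. Algebras are finite-dimensional except $\mathbb Z$-graded ones. For a bilinear operation $\ast$, $L_\ast(a)b=a\ast b$ and $R_\ast(a)b=b\ast a$. Completed tensor products: for $\mathbb Z$-graded $U=\bigoplus U_i$, $V=\bigoplus V_j$, $U\hat\otimes V:=\prod_{i,j}U_i\otimes V_j$ (similarly for more factors); elements are formal sums $\sum_{i,j,\alpha}u_{i,\alpha}\otimes v_{j,\alpha}$ with finitely many $\alpha$ for each $(i,j)$; linear maps and the flip ($\hat\tau$) are extended termwise, composites being understood to be well defined. $A$ is in degree $0$, $A\otimes B=\bigoplus_iA\otimes B_i$. $(a_1\otimes a_2)\bullet(x_1\otimes x_2)=(a_1\otimes x_1)\otimes(a_2\otimes x_2)$, extended linearly to formal sums. Leibniz-dendriform algebra: bilinear $\succ,\prec$ such that, with $x\circ y=x\succ y+x\prec y$: $(x\circ y)\succ z=x\succ(y\succ z)-y\succ(x\succ z)$; $y\prec(x\circ z)+(x\succ y)\prec z=x\succ(y\prec z)$; $x\prec(y\circ z)=(x\prec y)\prec z+y\succ(x\prec z)$. Leibniz-dendriform coalgebra: linear $\Delta_\succ,\Delta_\prec:A\to A\otimes A$ such that, with $\Delta=\Delta_\succ+\Delta_\prec$: $(\Delta\otimes I)\Delta_{\succ}=(I\otimes\Delta_{\succ})\Delta_{\succ}-(\tau\otimes I)(I\otimes\Delta_{\succ})\Delta_{\succ}$; $(I\otimes\Delta_{\prec})\Delta_{\succ}-(\Delta_{\succ}\otimes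 I)\Delta_{\prec}=(\tau\otimes I)(I\otimes\Delta)\Delta_{\prec}$; $(I\otimes\Delta)\Delta_{\prec}=(\Delta_{\prec}\otimes I)\Delta_{\prec}+(\tau\otimes I)(I\otimes\Delta_{\prec})\Delta_{\succ}$. Leibniz-dendriform bialgebra $(A,\succ,\prec,\Delta_\succ,\Delta_\prec)$: a Leibniz-dendriform algebra and coalgebra on $A$ such that for all $x,y\in A$, with $x\circ y=x\succ y+x\prec y$, $x\odot y=x\succ y+y\prec x$, $\Delta=\Delta_\succ+\Delta_\prec$, $\Delta_\odot=\Delta_\succ+\tau\Delta_\prec$ (so $L_\odot=L_\succ+R_\prec$, $R_\odot=L_\prec+R_\succ$): (1) $\Delta(x\odot y)-(I\otimes L_\odot(x))\Delta(y)+\tau(I\otimes L_\odot(x))\Delta(y)+\tau(I\otimes R_\odot(y))\Delta_\succ(x)-(I\otimes R_\odot(y))\Delta_\succ(x)=0$; (2) $\Delta(x\succ y)-(L_\succ(x)\otimes I+I\otimes L_\succ(x))\Delta(y)-(I\otimes R_\succ(y))\Delta_\odot(x)+\tau(I\otimes R_\odot(y))\Delta_\odot(x)=0$; (3) $(I\otimes R_\succ(y))\tau\Delta_\prec(x)-(R_\prec(x)\otimes I)\Delta(y)=0$; (4) $(\Delta_\succ+\tau\Delta_\prec)(x\circ y)-(I\otimes L_\circ(x)+L_\succ(x)\otimes I)\Delta_\odot(y)+(I\otimes L_\circ(y)+L_\succ(y)\otimes I)\Delta_\odot(x)=0$; (5) $\Delta_\succ(x\circ y)-(I\otimes R_\circ(y))\Delta_\succ(x)-(I\otimes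 L_\circ(x)+L_\odot(x)\otimes I)\Delta_\succ(y)+(L_\odot(y)\otimes I)\Delta_\odot(x)=0$; (6) $(I\otimes R_\circ(y))\tau\Delta_\prec(x)-(R_\prec(x)\otimes I)\Delta_\succ(y)=0$. Quadratic $\mathbb Z$-graded Zinbiel algebra $(B=\bigoplus B_i,\diamond,\omega)$: each $B_i$ is finite-dimensional, $B_i\diamond B_j\subseteq B_{i+j}$, $x\diamond(y\diamond z)=(x\diamond y)\diamond z+(y\diamond x)\diamond z$, and $\omega$ is a non-degenerate skew-symmetric bilinear form which is invariant, $\omega(x\diamond y,z)=\omega(y,x\diamond z+z\diamond x)$, and graded: there is $m\in\mathbb Z$ with $\omega(B_i,B_j)=0$ whenever $i+j+m\ne0$. The form $\hat\omega$ is $\hat\omega(\sum x_{1,i,\alpha}\otimes x_{2,j,\alpha},\,y_1\otimes y_2)=\sum\omega(x_{1,i,\alpha},y_1)\omega(x_{2,j,\alpha},y_2)$. Pre-Lie algebra: $(x\cdot y)\cdot z-x\cdot(y\cdot z)=(y\cdot x)\cdot z-y\cdot(x\cdot z)$. Completed pre-Lie coalgebra $(L,\delta)$: $L=\bigoplus L_i$, $\delta:L\to L\hat\otimes L$ linear with $(I\hat\otimes\delta)\delta-(\hat\tau\hat\otimes I)(I\hat\otimes\delta)\delta=(\delta\hat\otimes I)\delta-(\hat\tau\hat\otimes I)(\delta\hat\otimes I)\delta$. Completed pre-Lie bialgebra $(L,\cdot,\delta)$: $(L,\cdot)$ is a pre-Lie algebra, $(L,\delta)$ a completed pre-Lie coalgebra,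 and for all $a,b\in L$: $(\delta-\hat\tau\delta)(a\cdot b)-(L_\cdot(a)\hat\otimes I)(\delta-\hat\tau\delta)(b)-(I\hat\otimes L_\cdot(a))(\delta-\hat\tau\delta)(b)-(I\hat\otimes R_\cdot(b))\delta(a)+(R_\cdot(b)\hat\otimes I)\hat\tau\delta(a)=0$; $\delta(a\cdot b-b\cdot a)-(I\hat\otimes(R_\cdot(b)-L_\cdot(b)))\delta(a)-(I\hat\otimes(L_\cdot(a)-R_\cdot(a)))\delta(b)-(L_\cdot(a)\hat\otimes I)\delta(b)+(L_\cdot(b)\hat\otimes I)\delta(a)=0$. *)

(* Defs.v *)
From HB Require Import structures.
From mathcomp Require Import all_boot all_order all_algebra finmap.
From mathcomp Require Import boolp classical_sets functions cardinality fsbigop.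
From mathcomp Require Import sesquilinear.

Set Implicit Arguments.
Unset Strict Implicit.
Unset Printing Implicit Defensive.

Import GRing.Theory VectorInternalTheory.
Local Open Scope classical_set_scope.
Local Open Scope ring_scope.

Notation bilinear_map f := (bilinear_for *:%R *:%R f).
Notation bilinear_form f := (bilinear_for *%R *%R f).

(* The tensor product of finite-dimensional spaces, as matrices over their     *)
(* coordinate bases; pure_bilinear, tlift_linear, tlift_pure and tens_ext are  *)
(* its universal property.                                                     *)
Definition tens (K : fieldType) (U V : vectType K) : Type :=
  'M[K]_(dim U, dim V).
HB.instance Definition _ (K : fieldType) (U V : vectType K) :=
  Vector.on (tens U V).

Definition pure (K : fieldType) (U V : vectType K) (u : U) (v : V) : tens U V :=
  (v2r u)^T *m v2r v.
Notation "u \ox v" := (pure u v) (at level 40, left associativity).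

Definition bas (K : fieldType) (U : vectType K) (i : 'I_(dim U)) : U :=
  r2v (delta_mx 0 i).

(* The linear map on U (x) V induced by a bilinear map f on U x V. *)
Definition tlift (K : fieldType) (U V : vectType K) (W : lmodType K)
    (f : U -> V -> W) (t : tens U V) : W :=
  \sum_(i < dim U) \sum_(j < dim V) t i j *: f (bas i) (bas j).

Section TensorTheory.
Variable K : fieldType.
Implicit Types U V : vectType K.

Lemma bas_sum U (u : U) : u = \sum_i v2r u 0 i *: bas i.
Proof.
apply: v2r_inj; rewrite linear_sum /= [LHS]row_sum_delta.
by apply: eq_bigr => i _; rewrite linearZ /= r2vK.
Qed.

Lemma pureE U V (u : U) (v : V) i j : (u \ox v) i j = v2r u 0 i * v2r v 0 j.
Proof. by rewrite !mxE big_ord1 !mxE. Qed.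

Lemma pure_bilinear U V : bilinear_map (@pure K U V).
Proof.
split=> [v|u] a x y; rewrite /= /pure.
  by rewrite !linearP /= mulmxDl -scalemxAl.
by rewrite !linearP.
Qed.

Lemma tlift_linear U V (W : lmodType K) (f : U -> V -> W) : linear (tlift f).
Proof.
move=> a s t; rewrite /tlift scaler_sumr -big_split; apply: eq_bigr => i _ /=.
rewrite scaler_sumr -big_split; apply: eq_bigr => j _ /=.
by rewrite !mxE scalerDl scalerA.
Qed.

Lemma tlift_funP U V (W : lmodType K) c (f g h : U -> V -> W) t :
  (forall u v, f u v = c *: g u v + h u v) ->
  tlift f t = c *: tlift g t + tlift h t.
Proof.
move=> fE; rewrite /tlift scaler_sumr -big_split; apply: eq_bigr => i _ /=.
rewrite scaler_sumr -big_split; apply: eq_bigr => j _ /=.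
by rewrite fE scalerDr !scalerA mulrC.
Qed.

Lemma tlift_pure U V (W : lmodType K) (f : U -> V -> W) u v :
  bilinear_map f -> tlift f (u \ox v) = f u v.
Proof.
move=> [fl fr].
pose fL (y : V) : {linear U -> W} := HB.pack (f^~ y)
  (GRing.isLinear.Build K U W *:%R (f^~ y) (fl y)).
pose fR (x : U) : {linear V -> W} := HB.pack (f x)
  (GRing.isLinear.Build K V W *:%R (f x) (fr x)).
rewrite [in RHS](bas_sum u) -[RHS]/(fL v _) linear_sum; apply: eq_bigr => i _.
rewrite linearZ /= [in RHS](bas_sum v) -[f _ _]/(fR (bas i) _) linear_sum.
rewrite scaler_sumr; apply: eq_bigr => j _.
by rewrite linearZ /= scalerA pureE.
Qed.

Lemma tens_ext U V (W : lmodType K) (f g : tens U V -> W) :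
  linear f -> linear g -> (forall u v, f (u \ox v) = g (u \ox v)) -> f =1 g.
Proof.
move=> fl gl fg t.
pose f' : {linear tens U V -> W} :=
  HB.pack f (GRing.isLinear.Build K (tens U V) W *:%R f fl).
pose g' : {linear tens U V -> W} :=
  HB.pack g (GRing.isLinear.Build K (tens U V) W *:%R g gl).
have tE : t = \sum_i \sum_j t i j *: (bas i \ox bas j).
  apply/matrixP => k l; rewrite summxE (bigD1 k) //= summxE (bigD1 l) //=.
  rewrite !mxE big_ord1 !mxE !r2vK !mxE !eqxx !mulr1.
  rewrite !big1 ?addr0 //.
    move=> i ik; rewrite summxE big1 // => j _.
    by rewrite !mxE big_ord1 !mxE !r2vK !mxE (eq_sym k) (negPf ik) !(mul0r, mulr0).
  move=> j jl.
  by rewrite !mxE big_ord1 !mxE !r2vK !mxE (eq_sym l) (negPf jl) !mulr0.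
rewrite -[f t]/(f' t) -[g t]/(g' t) tE !linear_sum; apply: eq_bigr => i _.
by rewrite !linear_sum; apply: eq_bigr => j _; rewrite !linearZ /= fg.
Qed.

End TensorTheory.

Section TensorMaps.
Variable K : fieldType.
Implicit Types U V W : vectType K.

Definition tmap U U' V V' (f : U -> U') (g : V -> V') : tens U V -> tens U' V' :=
  tlift (fun u v => f u \ox g v).

Definition tflip U V : tens U V -> tens V U := tlift (fun u v => v \ox u).

(* Threefold tensors are bracketed to the left; tassoc rebrackets. *)
Definition tassoc U V W : tens U (tens V W) -> tens (tens U V) W :=
  tlift (fun u => tlift (fun v w => (u \ox v) \ox w)).

End TensorMaps.

Section LeibnizDendriform.
Variables (K : fieldType) (A : vectType K).

Local Notation tau := (@tflip K A A).

Record leibniz_dendriform_algebra (succ prec : A -> A -> A) : Prop := {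
  lda_succ_bilinear : bilinear_map succ;
  lda_prec_bilinear : bilinear_map prec;
  lda_circ_succ : let circ x y := succ x y + prec x y in
    forall x y z, succ (circ x y) z = succ x (succ y z) - succ y (succ x z);
  lda_succ_prec : let circ x y := succ x y + prec x y in
    forall x y z, prec y (circ x z) + prec (succ x y) z = succ x (prec y z);
  lda_prec_circ : let circ x y := succ x y + prec x y in
    forall x y z, prec x (circ y z) = prec (prec x y) z + succ y (prec x z)
}.

Record leibniz_dendriform_coalgebra (Ds Dp : A -> tens A A) : Prop := {
  ldc_succ_linear : linear Ds;
  ldc_prec_linear : linear Dp;
  ldc_circ_succ : let D x := Ds x + Dp x in
    forall x, tmap D id (Ds x) =
      tassoc (tmap id Ds (Ds x)) - tmap tau id (tassoc (tmap id Ds (Ds x)));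
  ldc_succ_prec : let D x := Ds x + Dp x in
    forall x, tassoc (tmap id Dp (Ds x)) - tmap Ds id (Dp x) =
      tmap tau id (tassoc (tmap id D (Dp x)));
  ldc_prec_circ : let D x := Ds x + Dp x in
    forall x, tassoc (tmap id D (Dp x)) =
      tmap Dp id (Dp x) + tmap tau id (tassoc (tmap id Dp (Ds x)))
}.

Record leibniz_dendriform_bialgebra
    (succ prec : A -> A -> A) (Ds Dp : A -> tens A A) : Prop := {
  ldb_algebra : leibniz_dendriform_algebra succ prec;
  ldb_coalgebra : leibniz_dendriform_coalgebra Ds Dp;
  ldb_odot :
    let odot x y := succ x y + prec y x in let D x := Ds x + Dp x in
    forall x y,
      D (odot x y) - tmap id (odot x) (D y) + tau (tmap id (odot x) (D y))
        + tau (tmap id (odot^~ y) (Ds x)) - tmap id (odot^~ y) (Ds x) = 0;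
  ldb_succ :
    let odot x y := succ x y + prec y x in let D x := Ds x + Dp x in
    let Dodot x := Ds x + tau (Dp x) in
    forall x y,
      D (succ x y) - (tmap (succ x) id (D y) + tmap id (succ x) (D y))
        - tmap id (succ^~ y) (Dodot x)
        + tau (tmap id (odot^~ y) (Dodot x)) = 0;
  ldb_mixed :
    let D x := Ds x + Dp x in
    forall x y, tmap id (succ^~ y) (tau (Dp x)) - tmap (prec^~ x) id (D y) = 0;
  ldb_Dodot_circ :
    let circ x y := succ x y + prec x y in let Dodot x := Ds x + tau (Dp x) in
    forall x y,
      Dodot (circ x y)
        - (tmap id (circ x) (Dodot y) + tmap (succ x) id (Dodot y))
        + (tmap id (circ y) (Dodot x) + tmap (succ y) id (Dodot x)) = 0;
  ldb_Dsucc_circ :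
    let circ x y := succ x y + prec x y in let odot x y := succ x y + prec y x in
    let Dodot x := Ds x + tau (Dp x) in
    forall x y,
      Ds (circ x y) - tmap id (circ^~ y) (Ds x)
        - (tmap id (circ x) (Ds y) + tmap (odot x) id (Ds y))
        + tmap (odot y) id (Dodot x) = 0;
  ldb_mixed_circ :
    let circ x y := succ x y + prec x y in
    forall x y, tmap id (circ^~ y) (tau (Dp x)) - tmap (prec^~ x) id (Ds y) = 0
}.

End LeibnizDendriform.

Definition dprod (K : fieldType) (I : Type) (V : I -> lmodType K) : Type :=
  forall i, V i.
HB.instance Definition _ (K : fieldType) (I : Type) (V : I -> lmodType K) :=
  Choice.on (dprod V).

Section Product.
Variables (K : fieldType) (I : Type) (V : I -> lmodType K).
Implicit Types f g h : dprod V.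

Let dadd f g : dprod V := fun i => f i + g i.
Let dopp f : dprod V := fun i => - f i.
Let dzero : dprod V := fun=> 0.
Let dscale (a : K) f : dprod V := fun i => a *: f i.

Let daddA : associative dadd.
Proof. by move=> f g h; apply: functional_extensionality_dep => i; apply: addrA. Qed.
Let daddC : commutative dadd.
Proof. by move=> f g; apply: functional_extensionality_dep => i; apply: addrC. Qed.
Let dadd0 : left_id dzero dadd.
Proof. by move=> f; apply: functional_extensionality_dep => i; apply: add0r. Qed.
Let daddN : left_inverse dzero dopp dadd.
Proof. by move=> f; apply: functional_extensionality_dep => i; apply: addNr. Qed.
HB.instance Definition _ :=
  GRing.isZmodule.Build (dprod V) daddA daddC dadd0 daddN.

Let dscaleA a b f : dscale a (dscale b f) = dscale (a * b) f.
Proof. by apply: functional_extensionality_dep => i; apply: scalerA. Qed.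
Let dscale1 : left_id 1 dscale.
Proof. by move=> f; apply: functional_extensionality_dep => i; apply: scale1r. Qed.
Let dscaleDr : right_distributive dscale +%R.
Proof. by move=> a f g; apply: functional_extensionality_dep => i; apply: scalerDr. Qed.
Let dscaleDl f : {morph dscale^~ f : a b / a + b}.
Proof. by move=> a b; apply: functional_extensionality_dep => i; apply: scalerDl. Qed.
HB.instance Definition _ :=
  GRing.Zmodule_isLmodule.Build K (dprod V) dscaleA dscale1 dscaleDr dscaleDl.

End Product.

Definition fin_supp (K : fieldType) (V : int -> vectType K) : {pred dprod V} :=
  fun f => `[< finite_set [set i | f i != 0] >].
Arguments fin_supp {K} V _.

(* The direct sum of the V i: the elements of finite support of the product. *)
Record dsum (K : fieldType) (V : int -> vectType K) : Type :=
  DSum { dval : dprod V; dvalP : dval \in fin_supp V }.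
Definition dcomp (K : fieldType) (V : int -> vectType K) (x : dsum V) :
  forall i, V i := dval x.
Arguments dcomp {K V} x i : simpl never.
Coercion dcomp : dsum >-> Funclass.

Section DirectSum.
Variables (K : fieldType) (V : int -> vectType K).

Lemma fin_supp_submod : submod_closed (fin_supp V).
Proof.
split=> [|a f g /asboolP ff /asboolP gf]; apply/asboolP.
  by rewrite (_ : [set _ | _] = set0) // -subset0 => i /=; rewrite eqxx.
apply: (@sub_finite_set _ _ ([set i | f i != 0] `|` [set i | g i != 0])).
  move=> i /=; case: (eqVneq (f i) 0) => [fi0|]; last by left.
  case: (eqVneq (g i) 0) => [gi0|]; last by right.
  by rewrite /GRing.add /GRing.scale /= fi0 gi0 scaler0 addr0 eqxx.
by rewrite finite_setU.
Qed.
HB.instance Definition _ := GRing.isSubmodClosed.Build K (dprod V) (fin_supp V)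
  fin_supp_submod.

HB.instance Definition _ := [isSub for @dval K V].
HB.instance Definition _ := [Choice of dsum V by <:].
HB.instance Definition _ := [SubChoice_isSubLmodule of dsum V by <:].

End DirectSum.

Section DirectSumTheory.
Variables (K : fieldType) (V : int -> vectType K).

Lemma dsum_finite (x : dsum V) : finite_set [set i | x i != 0].
Proof. exact: (asboolP _ (dvalP x)). Qed.

Lemma dsumD (x y : dsum V) i : (x + y) i = x i + y i.
Proof. by []. Qed.

Lemma dsumZ a (x : dsum V) i : (a *: x) i = a *: x i.
Proof. by []. Qed.

Lemma dsum_ext (x y : dsum V) : (forall i, x i = y i) -> x = y.
Proof. by move=> xy; apply: val_inj; apply: functional_extensionality_dep. Qed.

Lemma homog_subproof i (u : V i) :
  (dfwith (fun j => 0 : V j) u : dprod V) \in fin_supp V.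
Proof.
apply/asboolP; apply: (@sub_finite_set _ _ [set i]) => // j /=.
by case: (eqVneq i j) => [ij _|ij]; [exact/esym|rewrite dfwith_out // eqxx].
Qed.

(* The inclusion of V i in the direct sum. *)
Definition homog i (u : V i) : dsum V := DSum (homog_subproof u).

End DirectSumTheory.
Arguments homog {K V i} u : simpl never.

Section DirectSumDecomposition.
Variables (K : fieldType) (V : int -> vectType K).

Lemma homog_in i (u : V i) : homog u i = u.
Proof. by rewrite /homog /dcomp /= dfwith_in. Qed.

Lemma homog_out i j (u : V i) : i != j -> homog u j = 0.
Proof. by move=> ij; rewrite /homog /dcomp /= dfwith_out. Qed.

Lemma homog_linear i : linear (@homog K V i).
Proof.
move=> a u v; apply: dsum_ext => j; rewrite dsumD dsumZ.
case: (eqVneq i j) => [<-|ij]; first by rewrite !homog_in.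
by rewrite !homog_out // scaler0 addr0.
Qed.

Lemma homog0 i : homog (0 : V i) = 0.
Proof.
by apply: dsum_ext => j; case: (eqVneq i j) => [<-|ij];
  rewrite ?homog_in ?homog_out.
Qed.

Lemma dsum_sumE I (r : seq I) (P : pred I) (F : I -> dsum V) j :
  (\sum_(i <- r | P i) F i) j = \sum_(i <- r | P i) F i j.
Proof. by elim/big_rec2: _ => // i x y _ <-. Qed.

Lemma dsum_homog (x : dsum V) : x = \sum_(i \in [set: int]) homog (x i).
Proof.
have fx := dsum_finite x.
rewrite (fsbigTE (fset_set [set i | x i != 0])) => [|i].
  apply: dsum_ext => j; rewrite dsum_sumE.
  have [xj0|xj] := eqVneq (x j) 0.
    rewrite xj0 big1_seq // => i; rewrite in_fset_set //= inE /= => xi.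
    by rewrite homog_out //; apply: contraNneq xi => ->; rewrite xj0.
  rewrite (bigD1_seq j) ?fset_uniq ?in_fset_set ?inE //= homog_in.
  by rewrite big1 ?addr0 // => i ij; rewrite homog_out.
by rewrite in_fset_set // notin_setE /= => /negP; rewrite negbK => /eqP ->; exact: homog0.
Qed.
End DirectSumDecomposition.

Definition ctens2 (K : fieldType) (U V : int -> vectType K) : Type :=
  dprod (fun i => dprod (fun j => tens (U i) (V j))).
HB.instance Definition _ (K : fieldType) (U V : int -> vectType K) :=
  GRing.Lmodule.on (ctens2 U V).

Definition ctens3 (K : fieldType) (U V W : int -> vectType K) : Type :=
  dprod (fun i => dprod (fun j => dprod (fun k => tens (tens (U i) (V j)) (W k)))).
HB.instance Definition _ (K : fieldType) (U V W : int -> vectType K) :=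
  GRing.Lmodule.on (ctens3 U V W).

Section Completed.
Variable K : fieldType.
Implicit Types U V W : int -> vectType K.

Definition cflip U V (T : ctens2 U V) : ctens2 V U := fun j i => tflip (T i j).

Definition cflip12 U V W (T : ctens3 U V W) : ctens3 V U W :=
  fun j i k => tmap (@tflip _ _ _) id (T i j k).

(* Termwise extensions. Each component of the image of a formal sum is a sum   *)
(* over all degrees of the tensor factor the map is applied to; \sum_(i \in _) *)
(* is that sum when it has finite support, and the _def predicates say that it *)
(* does, so that the composite is well defined.                                *)

Definition cmapl_term U U' V (f : dsum U -> dsum U') (T : ctens2 U V) p q i :
  tens (U' p) (V q) := tmap (fun u => f (homog u) p) id (T i q).
Definition cmapl U U' V (f : dsum U -> dsum U') (T : ctens2 U V) : ctens2 U' V :=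
  fun p q => \sum_(i \in [set: int]) cmapl_term f T p q i.
Definition cmapl_def U U' V (f : dsum U -> dsum U') (T : ctens2 U V) : Prop :=
  forall p q, finite_set [set i | cmapl_term f T p q i != 0].

Definition cmapr_term U V V' (f : dsum V -> dsum V') (T : ctens2 U V) p q j :
  tens (U p) (V' q) := tmap id (fun v => f (homog v) q) (T p j).
Definition cmapr U V V' (f : dsum V -> dsum V') (T : ctens2 U V) : ctens2 U V' :=
  fun p q => \sum_(j \in [set: int]) cmapr_term f T p q j.
Definition cmapr_def U V V' (f : dsum V -> dsum V') (T : ctens2 U V) : Prop :=
  forall p q, finite_set [set j | cmapr_term f T p q j != 0].

Definition ccomull_term U V W X (d : dsum U -> ctens2 V W) (T : ctens2 U X)
    p q r i : tens (tens (V p) (W q)) (X r) :=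
  tmap (fun u => d (homog u) p q) id (T i r).
Definition ccomull U V W X (d : dsum U -> ctens2 V W) (T : ctens2 U X) :
    ctens3 V W X :=
  fun p q r => \sum_(i \in [set: int]) ccomull_term d T p q r i.
Definition ccomull_def U V W X (d : dsum U -> ctens2 V W) (T : ctens2 U X) : Prop :=
  forall p q r, finite_set [set i | ccomull_term d T p q r i != 0].

Definition ccomulr_term U V W X (d : dsum U -> ctens2 V W) (T : ctens2 X U)
    p q r j : tens (tens (X p) (V q)) (W r) :=
  tassoc (tmap id (fun u => d (homog u) q r) (T p j)).
Definition ccomulr U V W X (d : dsum U -> ctens2 V W) (T : ctens2 X U) :
    ctens3 X V W :=
  fun p q r => \sum_(j \in [set: int]) ccomulr_term d T p q r j.
Definition ccomulr_def U V W X (d : dsum U -> ctens2 V W) (T : ctens2 X U) : Prop :=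
  forall p q r, finite_set [set j | ccomulr_term d T p q r j != 0].

End Completed.

Section CompletedPreLie.
Variables (K : fieldType) (L : int -> vectType K).

Record prelie_algebra (mul : dsum L -> dsum L -> dsum L) : Prop := {
  prelie_bilinear : bilinear_map mul;
  prelie_assoc : forall x y z,
    mul (mul x y) z - mul x (mul y z) = mul (mul y x) z - mul y (mul x z)
}.

Record completed_prelie_coalgebra (delta : dsum L -> ctens2 L L) : Prop := {
  cplc_linear : linear delta;
  cplc_defl : forall x, ccomull_def delta (delta x);
  cplc_defr : forall x, ccomulr_def delta (delta x);
  cplc_coassoc : forall x,
    ccomulr delta (delta x) - cflip12 (ccomulr delta (delta x)) =
    ccomull delta (delta x) - cflip12 (ccomull delta (delta x))
}.

Record completed_prelie_bialgebra
    (mul : dsum L -> dsum L -> dsum L) (delta : dsum L -> ctens2 L L) : Prop := {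
  cplb_algebra : prelie_algebra mul;
  cplb_coalgebra : completed_prelie_coalgebra delta;
  cplb_def1 : let alt x := delta x - cflip (delta x) in
    forall a b, [/\ cmapl_def (mul a) (alt b), cmapr_def (mul a) (alt b),
      cmapr_def (mul^~ b) (delta a) & cmapl_def (mul^~ b) (cflip (delta a))];
  cplb_compat1 : let alt x := delta x - cflip (delta x) in
    forall a b,
      alt (mul a b) - cmapl (mul a) (alt b) - cmapr (mul a) (alt b)
        - cmapr (mul^~ b) (delta a) + cmapl (mul^~ b) (cflip (delta a)) = 0;
  cplb_def2 : forall a b,
    [/\ cmapr_def (fun x => mul x b - mul b x) (delta a),
        cmapr_def (fun x => mul a x - mul x a) (delta b),
        cmapl_def (mul a) (delta b) & cmapl_def (mul b) (delta a)];
  cplb_compat2 : forall a b,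
    delta (mul a b - mul b a)
      - cmapr (fun x => mul x b - mul b x) (delta a)
      - cmapr (fun x => mul a x - mul x a) (delta b)
      - cmapl (mul a) (delta b) + cmapl (mul b) (delta a) = 0
}.

End CompletedPreLie.

Section QuadraticZinbiel.
Variables (K : fieldType) (B : int -> vectType K).

Record quadratic_graded_zinbiel
    (dia : dsum B -> dsum B -> dsum B) (omega : dsum B -> dsum B -> K) : Prop := {
  qz_dia_bilinear : bilinear_map dia;
  qz_graded : forall i j (x : B i) (y : B j),
    exists z : B (i + j), dia (homog x) (homog y) = homog z;
  qz_zinbiel : forall x y z, dia x (dia y z) = dia (dia x y) z + dia (dia y x) z;
  qz_omega_bilinear : bilinear_form omega;
  qz_skew : forall x y, omega x y = - omega y x;
  qz_nondegenerate : forall x, (forall y, omega x y = 0) -> x = 0;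
  qz_invariant : forall x y z, omega (dia x y) z = omega y (dia x z + dia z x);
  qz_omega_graded : exists m : int, forall i j (x : B i) (y : B j),
    i + j + m != 0 -> omega (homog x) (homog y) = 0
}.

(* \hat\omega (T, y1 (x) y2). *)
Definition omega_hat (omega : dsum B -> dsum B -> K) (T : ctens2 B B)
    (y1 y2 : dsum B) : K :=
  \sum_(ij \in [set: int * int])
    tlift (fun u v => omega (homog u) y1 * omega (homog v) y2 : K^o) (T ij.1 ij.2).

End QuadraticZinbiel.

Section TensorGraded.
Variables (K : fieldType) (A : vectType K) (B : int -> vectType K).

Definition gtens (i : int) : vectType K := tens A (B i).

Lemma gpure_subproof (a : A) (x : dsum B) :
  ((fun i => a \ox x i) : dprod gtens) \in fin_supp gtens.
Proof.
apply/asboolP; apply: (sub_finite_set _ (dsum_finite x)) => i /=.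
by apply: contraNN => /eqP ->; rewrite /pure linear0 mulmx0.
Qed.

(* a (x) x in A (x) B, the direct sum of the A (x) B i. *)
Definition gpure (a : A) (x : dsum B) : dsum gtens := DSum (gpure_subproof a x).

(* The linear map on A (x) B induced by a bilinear map f on A x B. *)
Definition glift (W : lmodType K) (f : A -> dsum B -> W) (t : dsum gtens) : W :=
  \sum_(i \in [set: int]) tlift (fun a (x : B i) => f a (homog x)) (t i).

Definition bullet (s : tens A A) (T : ctens2 B B) : ctens2 gtens gtens :=
  fun i j => tlift (fun a1 a2 =>
    tlift (fun x1 x2 => (a1 \ox x1 : gtens i) \ox (a2 \ox x2 : gtens j)) (T i j)) s.

Definition tensor_mul (succ prec : A -> A -> A) (dia : dsum B -> dsum B -> dsum B)
    (s t : dsum gtens) : dsum gtens :=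
  glift (fun a x =>
    glift (fun b y => gpure (succ a b) (dia x y) - gpure (prec b a) (dia y x)) t) s.

Definition tensor_comul (Ds Dp : A -> tens A A) (eta : dsum B -> ctens2 B B)
    (t : dsum gtens) : ctens2 gtens gtens :=
  glift (fun a x =>
    bullet (Ds a) (eta x) - bullet (tflip (Dp a)) (cflip (eta x))) t.

Lemma glift_gpure (W : lmodType K) (f : A -> dsum B -> W) a x :
  bilinear_map f -> glift f (gpure a x) = f a x.
Proof.
move=> [fl fr].
pose fR : {linear dsum B -> W} := HB.pack (f a)
  (GRing.isLinear.Build K (dsum B) W *:%R (f a) (fr a)).
have fE (y : dsum B) : f a y = fR y by [].
have fx := dsum_finite x.
have E i : tlift (fun b (y : B i) => f b (homog y)) (gpure a x i) = f a (homog (x i)).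
  apply: tlift_pure; split=> [u|b] c y z; first exact: fl.
  by rewrite homog_linear fr.
have h0 i : x i = 0 -> homog (x i) = 0.
  by move=> ->; exact: homog0.
rewrite /glift (eq_fsbigr (fun i => f a (homog (x i)))) => [|i _]; last exact: E.
have ni i : i \notin fset_set [set i | x i != 0] -> x i = 0.
  by rewrite in_fset_set // notin_setE /= => /negP; rewrite negbK => /eqP.
rewrite [in RHS](dsum_homog x) (fsbigTE (fset_set [set i | x i != 0])) => [|i /ni xi]; last first.
  by rewrite h0 // fE linear0.
rewrite (fsbigTE (fset_set [set i | x i != 0])) => [|i /ni xi]; last exact: h0.
by rewrite fE linear_sum.
Qed.

Lemma gpure_bilinear : bilinear_map (gpure).
Proof.
split=> [x|a] c u v; apply: dsum_ext => i; rewrite dsumD dsumZ.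
  exact: (pure_bilinear _ _).1.
exact: (pure_bilinear _ _).2.
Qed.

Lemma tensor_mulE succ prec dia a x b y :
  bilinear_map succ -> bilinear_map prec -> bilinear_map dia ->
  tensor_mul succ prec dia (gpure a x) (gpure b y) =
  gpure (succ a b) (dia x y) - gpure (prec b a) (dia y x).
Proof.
move=> [sl sr] [pl pr] [dl dr]; have [gl gr] := gpure_bilinear.
have inner a' x' : bilinear_map
    (fun b y => gpure (succ a' b) (dia x' y) - gpure (prec b a') (dia y x')).
  split=> [y'|b'] c u v /=.
    by rewrite sr pl gl [in X in _ - X]gl scalerBr opprD addrACA.
  by rewrite dr dl gr [in X in _ - X]gr scalerBr opprD addrACA.
rewrite /tensor_mul glift_gpure ?glift_gpure //.
split=> [x'|a'] c u v /=; rewrite /= !glift_gpure //.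
  by rewrite sl pr gl [in X in _ - X]gl scalerBr opprD addrACA.
by rewrite dl dr gr [in X in _ - X]gr scalerBr opprD addrACA.
Qed.

Lemma bullet_bilinear : bilinear_map bullet.
Proof.
split=> [T|s] c u v; first (apply: functional_extensionality_dep => i;
  apply: functional_extensionality_dep => j; exact: tlift_linear).
apply: functional_extensionality_dep => i.
apply: functional_extensionality_dep => j.
by apply: tlift_funP => a1 a2; apply: tlift_linear.
Qed.

Lemma tensor_comulE Ds Dp eta a x :
  linear Ds -> linear Dp -> linear eta ->
  tensor_comul Ds Dp eta (gpure a x) =
  bullet (Ds a) (eta x) - bullet (tflip (Dp a)) (cflip (eta x)).
Proof.
move=> Dsl Dpl el; have [bl br] := bullet_bilinear.
have cl : linear (@cflip K B B).
  move=> c u v; apply: functional_extensionality_dep => i.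
  by apply: functional_extensionality_dep => j; exact: tlift_linear.
rewrite /tensor_comul glift_gpure //; split=> [y|b] c u v /=.
  by rewrite Dsl Dpl /tflip tlift_linear bl [in X in _ - X]bl scalerBr opprD addrACA.
by rewrite el cl br [in X in _ - X]br scalerBr opprD addrACA.
Qed.

End TensorGraded.

(* Main.v *)
Require Import Defs.
From HB Require Import structures.
From mathcomp Require Import all_boot all_order all_algebra.
From mathcomp Require Import boolp classical_sets functions cardinality fsbigop.
From mathcomp Require Import sesquilinear.
From mathcomp Require Import finmap ring.
Import GRing.Theory.
Import VectorInternalTheory.
Local Open Scope ring_scope.

(* Every identity in a completed tensor power of A (x) B is tested against the
   products of the forms l (x) omega(-, y), with l a linear form on A and y in B.
   They separate points because omega is non-degenerate and graded with
   finite-dimensional components.  Such a form turns delta into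
     (l (x) y, l' (x) y') |-> - omega(x, y y') (l (x) l')(Ds a)
                              + omega(x, y' y) (l' (x) l)(Dp a),
   and, by invariance of omega, multiplication by a (x) x transposes to
   operations of the same shape on the pairs (l, y).  So each identity becomes a
   scalar one, linear in omega(x, w) with w a product of the remaining three
   elements of B.  The Zinbiel identity writes w in terms of the six words
   (u1 u2) u3, and the coefficient of each word is a combination of the
   Leibniz-dendriform axioms.  By bilinearity pure tensors suffice. *)

(** The obstacle is that completed tensors are infinite formal sums, so no termwise composite or
    exchange of sums is automatic. Finiteness has two sources. A form omega(-, y) sees only finitely
    many degrees, since y has finite support and omega pairs B_i with B_{-m-i} only; hence every
    pairing is a finite sum. The maps involved are locally finite: multiplication by a fixed element
    shifts degrees by finitely many amounts, and eta is homogeneous because omega and the product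
    are, so a given output degree is reached from finitely many input degrees. The second fact
    yields the well-definedness conditions; together they let a pairing pass through a termwise
    extension by transposing the map onto the form. *)

Set Implicit Arguments.
Unset Strict Implicit.
Unset Printing Implicit Defensive.

(** * Evaluating tensors on pairs of linear forms *)

Section Evaluation.
Variable K : fieldType.
Implicit Types U V W : vectType K.

(** Forms are plain functions, with [scalar] as a separate hypothesis, so that composites such as
    [fun u => l (succ a u)] and nested evaluations [ev2 (ev2 f g) h] need no bundled structure. *)
Definition ev2 U V (f : U -> K) (g : V -> K) (t : tens U V) : K :=
  tlift (fun u v => f u * g v : K^o) t.

Lemma ev2_scalar U V (f : U -> K) (g : V -> K) : scalar (ev2 f g).
Proof. by move=> c s t; rewrite /ev2 tlift_linear. Qed.

Lemma ev2_pure U V (f : U -> K) (g : V -> K) u v :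
  scalar f -> scalar g -> ev2 f g (u \ox v) = f u * g v.
Proof.
move=> fl gl; rewrite /ev2 tlift_pure //; split=> [w|w] c x y /=.
  by rewrite fl mulrDl -mulrA.
by rewrite gl mulrDr mulrCA.
Qed.

Lemma form0 (U : lmodType K) (f : U -> K) : scalar f -> f 0 = 0.
Proof. by move=> fl; have := fl (-1) 0 0; rewrite scaleN1r addNr mulN1r addNr. Qed.

Lemma formD (U : lmodType K) (f : U -> K) : scalar f -> {morph f : x y / x + y}.
Proof. by move=> fl x y; have := fl 1 x y; rewrite scale1r mul1r. Qed.

Lemma formZ (U : lmodType K) (f : U -> K) c : scalar f -> {morph f : x / c *: x >-> c * x}.
Proof. by move=> fl x; have := fl c x 0; rewrite (form0 fl) !addr0. Qed.

Lemma formN (U : lmodType K) (f : U -> K) : scalar f -> {morph f : x / - x}.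
Proof. by move=> fl x; rewrite -scaleN1r formZ // mulN1r. Qed.

Lemma formB (U : lmodType K) (f : U -> K) : scalar f -> {morph f : x y / x - y}.
Proof. by move=> fl x y; rewrite formD // formN. Qed.

Lemma scalar_add (U : lmodType K) (f g : U -> K) :
  scalar f -> scalar g -> scalar (fun u => f u + g u).
Proof. by move=> fl gl c u v; rewrite fl gl mulrDr addrACA. Qed.

Lemma scalar_opp (U : lmodType K) (f : U -> K) : scalar f -> scalar (fun u => - f u).
Proof. by move=> fl c u v; rewrite fl opprD mulrN. Qed.

Lemma scalar_mul (U : lmodType K) d (f : U -> K) : scalar f -> scalar (fun u => d * f u).
Proof. by move=> fl c u v; rewrite fl mulrDr mulrCA. Qed.

Lemma form_sum (U : lmodType K) (f : U -> K) I (r : seq I) (P : pred I) (F : I -> U) :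
  scalar f -> f (\sum_(i <- r | P i) F i) = \sum_(i <- r | P i) f (F i).
Proof. by move=> fl; apply: (big_morph f (formD fl) (form0 fl)). Qed.

Lemma form_tlift U V (W : lmodType K) (f : W -> K) (h : U -> V -> W) t :
  scalar f -> f (tlift h t) = tlift (fun u v => f (h u v) : K^o) t.
Proof.
move=> fl; rewrite /tlift form_sum //; apply: eq_bigr => i _.
by rewrite form_sum //; apply: eq_bigr => j _; rewrite formZ.
Qed.

Lemma eq_tlift U V (W : lmodType K) (f g : U -> V -> W) t :
  (forall u v, f u v = g u v) -> tlift f t = tlift g t.
Proof. by move=> fg; congr tlift; apply/funext => u; apply/funext => v. Qed.

Lemma ev2_tmap U U' V V' (f : U' -> K) (g : V' -> K) (F : U -> U') (G : V -> V') t :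
  scalar f -> scalar g -> ev2 f g (tmap F G t) = ev2 (f \o F) (g \o G) t.
Proof.
move=> fl gl; rewrite /tmap (form_tlift _ _ (ev2_scalar f g)).
by rewrite [RHS]/ev2; apply: (eq_tlift (W := K^o)) => u v; rewrite ev2_pure.
Qed.

Lemma ev2_tflip U V (f : V -> K) (g : U -> K) (t : tens U V) :
  scalar f -> scalar g -> ev2 f g (tflip t) = ev2 g f t.
Proof.
move=> fl gl; rewrite /tflip (form_tlift _ _ (ev2_scalar f g)).
by rewrite [RHS]/ev2; apply: (eq_tlift (W := K^o)) => u v; rewrite ev2_pure // mulrC.
Qed.

Lemma ev2_tassoc U V W (f : U -> K) (g : V -> K) (h : W -> K) t :
  scalar f -> scalar g -> scalar h ->
  ev2 (ev2 f g) h (tassoc t) = ev2 f (ev2 g h) t.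
Proof.
move=> fl gl hl; have fgl := ev2_scalar f g.
rewrite /tassoc (form_tlift _ _ (ev2_scalar _ h)).
rewrite [RHS]/ev2; apply: (eq_tlift (W := K^o)) => u v; rewrite (form_tlift _ _ (ev2_scalar _ h)).
rewrite [in RHS]/ev2 /tlift mulr_sumr; apply: eq_bigr => i _.
rewrite mulr_sumr; apply: eq_bigr => j _.
by rewrite !ev2_pure // /GRing.scale /=; ring.
Qed.

Lemma ev2_linl U V c (f f' : U -> K) (g : V -> K) t :
  ev2 (fun u => c * f u + f' u) g t = c * ev2 f g t + ev2 f' g t.
Proof. by rewrite /ev2; apply: (tlift_funP (W := K^o)) => u v; rewrite /GRing.scale /=; ring. Qed.

Lemma ev2_linr U V c (f : U -> K) (g g' : V -> K) t :
  ev2 f (fun u => c * g u + g' u) t = c * ev2 f g t + ev2 f g' t.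
Proof. by rewrite /ev2; apply: (tlift_funP (W := K^o)) => u v; rewrite /GRing.scale /=; ring. Qed.

Lemma coord_scalar U (i : 'I_(dim U)) : scalar (fun u : U => v2r u 0 i).
Proof. by move=> c u v; rewrite /= linearP !mxE. Qed.

(** Tensors are matrices over coordinate bases, so coordinate forms read off their entries; this is
    why products of forms separate tensors. *)
Lemma ev2_coord U V (t : tens U V) i j :
  ev2 (fun u => v2r u 0 i) (fun v => v2r v 0 j) t = t i j.
Proof.
rewrite /ev2 /tlift (bigD1 i) //= (bigD1 j) //= !r2vK !mxE !eqxx.
rewrite !big1 ?addr0.
- by rewrite !mulr1 /GRing.scale /= mulr1.
- move=> k ki; rewrite big1 // => l _.
  by rewrite !r2vK !mxE eq_sym (negPf ki) mul0r scaler0.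
- move=> l lj.
  by rewrite !r2vK !mxE [j == l]eq_sym (negPf lj) mulr0 scaler0.
Qed.

Lemma ev2_suml U V I (r : seq I) (f : I -> U -> K) (g : V -> K) t :
  ev2 (fun u => \sum_(i <- r) f i u) g t = \sum_(i <- r) ev2 (f i) g t.
Proof.
rewrite /ev2 /tlift [RHS]exchange_big; apply: eq_bigr => i _ /=.
rewrite [RHS]exchange_big; apply: eq_bigr => j _ /=.
by rewrite mulr_suml /GRing.scale /= mulr_sumr.
Qed.

Lemma ev2_sumr U V I (r : seq I) (f : U -> K) (g : I -> V -> K) t :
  ev2 f (fun u => \sum_(i <- r) g i u) t = \sum_(i <- r) ev2 f (g i) t.
Proof.
rewrite /ev2 /tlift [RHS]exchange_big; apply: eq_bigr => i _ /=.
rewrite [RHS]exchange_big; apply: eq_bigr => j _ /=.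
by rewrite mulr_sumr /GRing.scale /= mulr_sumr.
Qed.

Lemma ev20l U V (f : U -> K) (g : V -> K) t : (forall u, f u = 0) -> ev2 f g t = 0.
Proof.
move=> f0; rewrite /ev2 /tlift big1 // => i _; rewrite big1 // => j _.
by rewrite f0 mul0r scaler0.
Qed.

Lemma ev20r U V (f : U -> K) (g : V -> K) t : (forall u, g u = 0) -> ev2 f g t = 0.
Proof.
move=> g0; rewrite /ev2 /tlift big1 // => i _; rewrite big1 // => j _.
by rewrite g0 mulr0 scaler0.
Qed.

Lemma tlift0 U V (W : lmodType K) (f : U -> V -> W) t :
  (forall u v, f u v = 0) -> tlift f t = 0.
Proof.
by move=> f0; rewrite /tlift big1 // => i _; rewrite big1 // => j _; rewrite f0 scaler0.
Qed.

Lemma pure0l U V (v : V) : (0 : U) \ox v = 0.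
Proof. by rewrite /pure linear0 trmx0 mul0mx. Qed.

Lemma pure0r U V (u : U) : u \ox (0 : V) = 0.
Proof. by rewrite /pure linear0 mulmx0. Qed.

Lemma tlift_at0 U V (W : lmodType K) (f : U -> V -> W) : tlift f 0 = 0.
Proof. by rewrite /tlift big1 // => i _; rewrite big1 // => j _; rewrite mxE scale0r. Qed.

Lemma ev2Dl (U V : vectType K) (f f' : U -> K) (g : V -> K) t :
  ev2 (fun u => f u + f' u) g t = ev2 f g t + ev2 f' g t.
Proof.
rewrite -[X in _ = X + _]mul1r -ev2_linl; congr ev2.
by apply/funext => u; rewrite mul1r.
Qed.

Lemma ev2Dr (U V : vectType K) (f : U -> K) (g g' : V -> K) t :
  ev2 f (fun u => g u + g' u) t = ev2 f g t + ev2 f g' t.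
Proof.
rewrite -[X in _ = X + _]mul1r -ev2_linr; congr ev2.
by apply/funext => u; rewrite mul1r.
Qed.

Lemma ev2_tmapl (U U' V : vectType K) (F : U -> U') (f : U' -> K) (g : V -> K) t :
  scalar f -> scalar g -> ev2 f g (tmap F id t) = ev2 (fun u => f (F u)) g t.
Proof. exact: ev2_tmap. Qed.

Lemma ev2_tmapr (U V V' : vectType K) (G : V -> V') (f : U -> K) (g : V' -> K) t :
  scalar f -> scalar g -> ev2 f g (tmap id G t) = ev2 f (fun v => g (G v)) t.
Proof. exact: ev2_tmap. Qed.

Lemma ev2_tmaplD (U U' V : vectType K) (F G : U -> U') (f : U' -> K) (g : V -> K) t :
  scalar f -> scalar g -> ev2 f g (tmap (fun u => F u + G u) id t) =
  ev2 (fun u => f (F u)) g t + ev2 (fun u => f (G u)) g t.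
Proof.
move=> fl gl; rewrite ev2_tmapl // -ev2Dl; congr ev2.
by apply/funext => u; rewrite (formD fl).
Qed.

Lemma ev2_tmaprD (U V V' : vectType K) (F G : V -> V') (f : U -> K) (g : V' -> K) t :
  scalar f -> scalar g -> ev2 f g (tmap id (fun u => F u + G u) t) =
  ev2 f (fun u => g (F u)) t + ev2 f (fun u => g (G u)) t.
Proof.
move=> fl gl; rewrite ev2_tmapr // -ev2Dr; congr ev2.
by apply/funext => u; rewrite (formD gl).
Qed.

End Evaluation.

Ltac scalar_tac := repeat lazymatch goal with
  | |- _ (fun u => @?f u + @?g u) => apply: (@scalar_add _ _ f g)
  | |- _ (fun u => - @?f u) => apply: (@scalar_opp _ _ f)
  | |- _ (fun u => ?d * @?f u) => apply: (@scalar_mul _ _ d f)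
  end.

(** * Evaluating completed tensors *)

Section Pairing.
Variable K : fieldType.
Implicit Types U V W : int -> vectType K.

Definition degrees V (x : dsum V) : {fset int} :=
  fset_set [set i | x i != 0]%classic.

Lemma degreesP V (x : dsum V) i : i \notin degrees x -> x i = 0.
Proof.
rewrite in_fset_set; last exact: dsum_finite.
by rewrite notin_setE /= => /negP; rewrite negbK => /eqP.
Qed.

(* Boundedness of the degrees seen by a form makes its pairing with formal   *)
(* sums finite.                                                              *)
Definition supported U (phi : dsum U -> K) (S : {fset int}) : Prop :=
  forall i, i \notin S -> forall u : U i, phi (homog u) = 0.

(** These are the linear forms continuous for the product topology with discrete factors, that is,
    those that extend to all of [dprod U]. *)
Definition continuous_form U (phi : dsum U -> K) : Prop :=
  scalar phi /\ exists S, supported phi S.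

(** The sum runs over all pairs of degrees, as in [omega_hat], which is then an instance by
    definition; [pairingE] replaces it by finite sums. *)
Definition pairing U V (phi : dsum U -> K) (psi : dsum V -> K) (T : ctens2 U V) : K :=
  \sum_(ij \in [set: int * int])
    ev2 (fun u => phi (homog u)) (fun v => psi (homog v)) (T ij.1 ij.2).

(* The condition under which the termwise extension of F to completed        *)
(* tensor products is defined on every formal sum.                           *)
Definition locally_finite U (I : Type) (W : I -> lmodType K)
    (F : dsum U -> forall p, W p) : Prop :=
  forall p, exists S : {fset int}, forall i, i \notin S -> forall u : U i, F (homog u) p = 0.

(** The finite set provided by [locally_finite] depends on p. A form sees only finitely many p, and
    for these the union of the sets serves. *)
Lemma locally_finite_uniform U (I : choiceType) (W : I -> lmodType K)
    (F : dsum U -> forall p, W p) (r : seq I) :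
  locally_finite F ->
  exists S : {fset int}, forall p, p \in r -> forall i, i \notin S ->
    forall u : U i, F (homog u) p = 0.
Proof.
move=> /choice[f fP]; exists (\bigcup_(p <- r) f p)%fset => p pr i iS u.
apply: fP; apply: contra iS; apply: fsubsetP.
exact: (bigfcup_sup (P := xpredT)).
Qed.

Lemma homog_scalar U (phi : dsum U -> K) i :
  scalar phi -> scalar (fun u : U i => phi (homog u)).
Proof. by move=> phil c u v; rewrite homog_linear phil. Qed.

(** Outside S x S' one of the two forms vanishes. Any supporting sets are allowed, so that pairings
    with several forms can be put over a common range. *)
Lemma pairingE U V (phi : dsum U -> K) (psi : dsum V -> K) S S' T :
  supported phi S -> supported psi S' ->
  pairing phi psi T = \sum_(i <- S) \sum_(j <- S')
    ev2 (fun u => phi (homog u)) (fun v => psi (homog v)) (T i j).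
Proof.
move=> phiS psiS; rewrite /pairing (fsbigTE (S `*` S')%fset); last first.
  move=> [i j]; rewrite in_fsetM /= negb_and => /orP[iS|jS].
    by rewrite ev20l // => u; exact: phiS.
  by rewrite ev20r // => u; exact: psiS.
rewrite -(big_allpairs (F := fun ij => ev2 (fun u => phi (homog u))
  (fun v => psi (homog v)) (T ij.1 ij.2))); apply: perm_big.
rewrite uniq_perm ?fset_uniq //.
  by apply: allpairs_uniq => [||[? ?] [? ?] _ _ [-> ->]] //; exact: fset_uniq.
move=> [i j]; rewrite in_fsetM /=.
apply/andP/allpairsP => [[iS jS]|[[k l] /= [kS lS [-> ->]]]] //.
by exists (i, j).
Qed.

Lemma continuous_formE U (phi : dsum U -> K) S x :
  scalar phi -> supported phi S -> phi x = \sum_(i <- S) phi (homog (x i)).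
Proof.
move=> phil phiS; rewrite [in LHS](dsum_homog x).
rewrite (fsbigTE (degrees x)) => [|i /degreesP ->]; last exact: homog0.
(* The sums over [degrees x] and over [S] both equal the sum over all degrees: a term vanishes
   outside the first set because x does, outside the second because phi does. *)
rewrite form_sum // -(fsbigTE _ (fun i => phi (homog (x i)))) => [|i /degreesP ->].
  by apply: fsbigTE => i iS; exact: phiS.
by rewrite homog0 form0.
Qed.

Lemma pairing_scalar U V (phi : dsum U -> K) (psi : dsum V -> K) :
  continuous_form phi -> continuous_form psi -> scalar (pairing phi psi).
Proof.
move=> [_ [S phiS]] [_ [S' psiS]] c T T'.
rewrite !(pairingE _ phiS psiS) mulr_sumr -big_split; apply: eq_bigr => i _ /=.
rewrite mulr_sumr -big_split; apply: eq_bigr => j _ /=.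
exact: ev2_scalar.
Qed.

Lemma supportedS U (phi : dsum U -> K) (S S' : {fset int}) :
  (S `<=` S')%fset -> supported phi S -> supported phi S'.
Proof. by move=> SS' phiS i iS'; apply: phiS; apply: contra iS'; exact: (fsubsetP SS'). Qed.

Lemma pairing_linl U V c (phi phi' : dsum U -> K) (psi : dsum V -> K) T :
  continuous_form phi -> continuous_form phi' -> continuous_form psi ->
  pairing (fun u => c * phi u + phi' u) psi T =
  c * pairing phi psi T + pairing phi' psi T.
Proof.
move=> [_ [S1 h1]] [_ [S2 h2]] [_ [S' h']].
have {}h1 := supportedS (fsubsetUl S1 S2) h1.
have {}h2 := supportedS (fsubsetUr S1 S2) h2.
rewrite (pairingE _ h1 h') (pairingE _ h2 h') (pairingE (S := (S1 `|` S2)%fset) _ _ h').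
  rewrite mulr_sumr -big_split; apply: eq_bigr => i _ /=.
  by rewrite mulr_sumr -big_split; apply: eq_bigr => j _ /=; exact: ev2_linl.
by move=> i iS u; rewrite h1 // h2 // mulr0 addr0.
Qed.

Lemma pairing_flip U V (phi : dsum U -> K) (psi : dsum V -> K) T :
  continuous_form phi -> continuous_form psi ->
  pairing phi psi (cflip T) = pairing psi phi T.
Proof.
move=> [phil [S h]] [psil [S' h']].
rewrite (pairingE _ h h') (pairingE _ h' h) exchange_big.
apply: eq_bigr => j _; apply: eq_bigr => i _.
by rewrite /cflip ev2_tflip //; exact: homog_scalar.
Qed.

Lemma pairing_linr U V c (phi : dsum U -> K) (psi psi' : dsum V -> K) T :
  continuous_form phi -> continuous_form psi -> continuous_form psi' ->
  pairing phi (fun u => c * psi u + psi' u) T =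
  c * pairing phi psi T + pairing phi psi' T.
Proof.
move=> [_ [S' h']] [_ [S1 h1]] [_ [S2 h2]].
have {}h1 := supportedS (fsubsetUl S1 S2) h1.
have {}h2 := supportedS (fsubsetUr S1 S2) h2.
rewrite (pairingE _ h' h1) (pairingE _ h' h2) (pairingE (S' := (S1 `|` S2)%fset) _ h').
  rewrite mulr_sumr -big_split; apply: eq_bigr => i _ /=.
  by rewrite mulr_sumr -big_split; apply: eq_bigr => j _ /=; exact: ev2_linr.
by move=> i iS u; rewrite h1 // h2 // mulr0 addr0.
Qed.

(** phi reads finitely many components of [F u], and each of them is reached from finitely many
    degrees. *)
Lemma continuous_form_comp U V (phi : dsum V -> K) (F : dsum U -> dsum V) :
  continuous_form phi -> linear F -> locally_finite (fun x => dcomp (F x)) ->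
  continuous_form (fun u => phi (F u)).
Proof.
move=> [phil [S h]] Fl Ff; split; first by move=> c u v; rewrite Fl phil.
have [S' S'P] := locally_finite_uniform S Ff; exists S' => i iS' u.
rewrite (continuous_formE _ phil h) big1_seq // => p /= pS.
by rewrite S'P // homog0 form0.
Qed.

(** For p in the support of phi only the degrees in one finite set contribute to [cmapl], so its sum
    can be exchanged with the pairing; the sum over p then reassembles [phi (F u)]. *)
Lemma pairing_cmapl U U' V (F : dsum U -> dsum U') (phi : dsum U' -> K)
    (psi : dsum V -> K) T :
  continuous_form phi -> continuous_form psi ->
  linear F -> locally_finite (fun x => dcomp (F x)) ->
  pairing phi psi (cmapl F T) = pairing (fun u => phi (F u)) psi T.
Proof.
move=> [phil [S h]] [psil [S' h']] Fl Ff.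
have [S'' S''P] := locally_finite_uniform S Ff.
have hF : supported (fun u => phi (F u)) S''.
  move=> i iS u; rewrite (continuous_formE _ phil h) big1_seq // => p /= pS.
  by rewrite S''P // homog0 form0.
rewrite (pairingE _ h h') (pairingE _ hF h').
transitivity (\sum_(p <- S) \sum_(q <- S') \sum_(i <- S'')
    ev2 (fun u => phi (homog (F (homog u) p))) (fun v => psi (homog v)) (T i q)).
  apply: eq_big_seq => p pS; apply: eq_bigr => q _.
  rewrite /cmapl (fsbigTE S'') => [|i iS]; last first.
    by rewrite /cmapl_term /tmap tlift0 // => u v; rewrite S''P // pure0l.
  rewrite (form_sum _ _ _ (ev2_scalar _ _)); apply: eq_bigr => i _.
  by rewrite /cmapl_term ev2_tmap //; exact: homog_scalar.
rewrite exchange_big /=; under eq_bigr do rewrite exchange_big /=.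
rewrite exchange_big; apply: eq_bigr => i _; apply: eq_bigr => q _ /=.
by rewrite -ev2_suml; congr ev2; apply/funext => u; rewrite (continuous_formE _ phil h).
Qed.

Lemma pairing_cmapr U V V' (F : dsum V -> dsum V') (phi : dsum U -> K)
    (psi : dsum V' -> K) T :
  continuous_form phi -> continuous_form psi ->
  linear F -> locally_finite (fun x => dcomp (F x)) ->
  pairing phi psi (cmapr F T) = pairing phi (fun u => psi (F u)) T.
Proof.
move=> [phil [S h]] [psil [S' h']] Fl Ff.
have [S'' S''P] := locally_finite_uniform S' Ff.
have hF : supported (fun u => psi (F u)) S''.
  move=> i iS u; rewrite (continuous_formE _ psil h') big1_seq // => p /= pS.
  by rewrite S''P // homog0 form0.
rewrite (pairingE _ h h') (pairingE _ h hF); apply: eq_bigr => p _.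
transitivity (\sum_(q <- S') \sum_(i <- S'')
    ev2 (fun u => phi (homog u)) (fun v => psi (homog (F (homog v) q))) (T p i)).
  apply: eq_big_seq => q qS.
  rewrite /cmapr (fsbigTE S'') => [|i iS]; last first.
    by rewrite /cmapr_term /tmap tlift0 // => u v; rewrite S''P // pure0r.
  rewrite (form_sum _ _ _ (ev2_scalar _ _)); apply: eq_bigr => i _.
  by rewrite /cmapr_term ev2_tmap //; exact: homog_scalar.
rewrite exchange_big; apply: eq_bigr => i _ /=.
by rewrite -ev2_sumr; congr ev2; apply/funext => u; rewrite (continuous_formE _ psil h').
Qed.

(* The ranges of summation are explicit, which makes pairing3 linear in T    *)
(* without any condition on the forms.                                       *)
Definition pairing3 U V W (S1 S2 S3 : {fset int}) (phi : dsum U -> K)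
    (psi : dsum V -> K) (chi : dsum W -> K) (T : ctens3 U V W) : K :=
  \sum_(p <- S1) \sum_(q <- S2) \sum_(r <- S3)
    ev2 (ev2 (fun u => phi (homog u)) (fun v => psi (homog v)))
      (fun w => chi (homog w)) (T p q r).

Lemma pairing3_scalar U V W S1 S2 S3 (phi : dsum U -> K)
    (psi : dsum V -> K) (chi : dsum W -> K) : scalar (pairing3 S1 S2 S3 phi psi chi).
Proof.
move=> c T T'; rewrite /pairing3.
rewrite mulr_sumr -big_split; apply: eq_bigr => i _ /=.
rewrite mulr_sumr -big_split; apply: eq_bigr => j _ /=.
rewrite mulr_sumr -big_split; apply: eq_bigr => k _ /=.
exact: ev2_scalar.
Qed.

Lemma pairing3_flip U V W S1 S2 S3 (phi : dsum U -> K)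
    (psi : dsum V -> K) (chi : dsum W -> K) T :
  scalar phi -> scalar psi -> scalar chi ->
  pairing3 S1 S2 S3 phi psi chi (cflip12 T) = pairing3 S2 S1 S3 psi phi chi T.
Proof.
move=> phil psil chil; rewrite /pairing3 exchange_big.
apply: eq_bigr => q _; apply: eq_bigr => p _; apply: eq_bigr => r _.
rewrite /cflip12 ev2_tmap; [|exact: ev2_scalar|exact: homog_scalar].
by congr ev2; apply/funext => t /=; rewrite ev2_tflip //; exact: homog_scalar.
Qed.

Section Comultiplication.
Variables (U V W X : int -> vectType K) (S1 S2 S3 : {fset int}).
Variables (d : dsum U -> ctens2 V W).
Hypothesis df : locally_finite
  (W := fun pq : int * int => tens (V pq.1) (W pq.2) : lmodType K)
  (fun x pq => d x pq.1 pq.2).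

Lemma comul_uniform (S S' : {fset int}) : exists S'' : {fset int},
  forall p q, p \in S -> q \in S' -> forall i, i \notin S'' ->
    forall u : U i, d (homog u) p q = 0.
Proof.
have [S'' S''P] := locally_finite_uniform [seq (p, q) | p <- S, q <- S'] df.
exists S'' => p q pS qS i iS u.
have pq : (p, q) \in [seq (p, q) | p <- S, q <- S'] by apply/allpairsP; exists (p, q).
exact: (S''P _ pq _ iS u).
Qed.

(** Transposition as in [pairing_cmapl]: the first two forms are pulled back along d to a single
    form, which reduces a threefold pairing to a twofold one. *)
Lemma pairing3_ccomull (phi : dsum V -> K) (psi : dsum W -> K) (chi : dsum X -> K) T :
  scalar phi -> scalar psi -> scalar chi ->
  supported phi S1 -> supported psi S2 -> supported chi S3 ->
  pairing3 S1 S2 S3 phi psi chi (ccomull d T) =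
  pairing (fun u => pairing phi psi (d u)) chi T.
Proof.
move=> phil psil chil h1 h2 h3.
have [S'' S''P] := comul_uniform S1 S2.
have hF : supported (fun u => pairing phi psi (d u)) S''.
  move=> i iS u; rewrite (pairingE _ h1 h2) big1_seq // => p /= pS.
  by rewrite big1_seq // => q qS; rewrite S''P // (form0 (ev2_scalar _ _)).
rewrite (pairingE _ hF h3) /pairing3.
transitivity (\sum_(p <- S1) \sum_(q <- S2) \sum_(r <- S3) \sum_(i <- S'')
    ev2 (fun u => ev2 (fun u => phi (homog u)) (fun v => psi (homog v))
           (d (homog u) p q)) (fun w => chi (homog w)) (T i r)).
  apply: eq_big_seq => p pS; apply: eq_big_seq => q qS; apply: eq_bigr => r _.
  rewrite /ccomull (fsbigTE S'') => [|i iS]; last first.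
    by rewrite /ccomull_term /tmap tlift0 // => u v; rewrite S''P // pure0l.
  rewrite (form_sum _ _ _ (ev2_scalar _ _)); apply: eq_bigr => i _.
  by rewrite /ccomull_term ev2_tmap //; [exact: ev2_scalar|exact: homog_scalar].
(* The sums over p and q go innermost, where they rebuild [pairing phi psi (d u)]. *)
transitivity (\sum_(i <- S'') \sum_(r <- S3) \sum_(p <- S1) \sum_(q <- S2)
    ev2 (fun u => ev2 (fun u => phi (homog u)) (fun v => psi (homog v))
           (d (homog u) p q)) (fun w => chi (homog w)) (T i r)).
  rewrite [RHS]exchange_big /=.
  under [RHS]eq_bigr do rewrite exchange_big /=.
  rewrite [RHS]exchange_big; apply: eq_bigr => p _ /=.
  under [RHS]eq_bigr do rewrite exchange_big /=.
  by rewrite [RHS]exchange_big.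
apply: eq_bigr => i _; apply: eq_bigr => r _.
under eq_bigr do rewrite -ev2_suml.
rewrite -ev2_suml; congr ev2; apply/funext => u.
by rewrite (pairingE _ h1 h2).
Qed.

Lemma pairing3_ccomulr (chi : dsum X -> K) (phi : dsum V -> K) (psi : dsum W -> K) T :
  scalar phi -> scalar psi -> scalar chi ->
  supported chi S1 -> supported phi S2 -> supported psi S3 ->
  pairing3 S1 S2 S3 chi phi psi (ccomulr d T) =
  pairing chi (fun u => pairing phi psi (d u)) T.
Proof.
move=> phil psil chil h1 h2 h3.
have [S'' S''P] := comul_uniform S2 S3.
have hF : supported (fun u => pairing phi psi (d u)) S''.
  move=> i iS u; rewrite (pairingE _ h2 h3) big1_seq // => p /= pS.
  by rewrite big1_seq // => q qS; rewrite S''P // (form0 (ev2_scalar _ _)).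
rewrite (pairingE _ h1 hF) /pairing3; apply: eq_bigr => p _.
transitivity (\sum_(q <- S2) \sum_(r <- S3) \sum_(i <- S'')
    ev2 (fun w => chi (homog w))
      (fun u => ev2 (fun u => phi (homog u)) (fun v => psi (homog v))
           (d (homog u) q r)) (T p i)).
  apply: eq_big_seq => q qS; apply: eq_big_seq => r rS.
  rewrite /ccomulr (fsbigTE S'') => [|i iS]; last first.
    rewrite /ccomulr_term /tassoc [tmap _ _ _]tlift0; first exact: tlift_at0.
    by move=> u v; rewrite S''P // pure0r.
  rewrite (form_sum _ _ _ (ev2_scalar _ _)); apply: eq_bigr => i _.
  rewrite /ccomulr_term ev2_tassoc; try exact: homog_scalar.
  by rewrite ev2_tmap //; [exact: homog_scalar|exact: ev2_scalar].
under eq_bigr do rewrite exchange_big /=.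
rewrite exchange_big /=; apply: eq_bigr => i _.
under eq_bigr do rewrite -ev2_sumr.
rewrite -ev2_sumr; congr ev2; apply/funext => u.
by rewrite (pairingE _ h2 h3).
Qed.

End Comultiplication.

Lemma cmapl_def_lf U U' V (F : dsum U -> dsum U') (T : ctens2 U V) :
  locally_finite (fun x => dcomp (F x)) -> cmapl_def F T.
Proof.
move=> Ff p q; have [S SP] := Ff p; apply: (sub_finite_set _ (finite_seq S)) => i /=.
by apply: contraNT => iS; rewrite /cmapl_term /tmap tlift0 // => u v; rewrite SP // pure0l.
Qed.

Lemma cmapr_def_lf U V V' (F : dsum V -> dsum V') (T : ctens2 U V) :
  locally_finite (fun x => dcomp (F x)) -> cmapr_def F T.
Proof.
move=> Ff p q; have [S SP] := Ff q; apply: (sub_finite_set _ (finite_seq S)) => i /=.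
by apply: contraNT => iS; rewrite /cmapr_term /tmap tlift0 // => u v; rewrite SP // pure0r.
Qed.

Lemma ccomull_def_lf U V W X (d : dsum U -> ctens2 V W) (T : ctens2 U X) :
  locally_finite (W := fun pq : int * int => tens (V pq.1) (W pq.2) : lmodType K)
    (fun x pq => d x pq.1 pq.2) -> ccomull_def d T.
Proof.
move=> df p q r; have [S SP] := df (p, q).
apply: (sub_finite_set _ (finite_seq S)) => i /=.
apply: contraNT => iS; rewrite /ccomull_term /tmap tlift0 // => u v.
by have /= -> := SP _ iS u; rewrite pure0l.
Qed.

Lemma ccomulr_def_lf U V W X (d : dsum U -> ctens2 V W) (T : ctens2 X U) :
  locally_finite (W := fun pq : int * int => tens (V pq.1) (W pq.2) : lmodType K)
    (fun x pq => d x pq.1 pq.2) -> ccomulr_def d T.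
Proof.
move=> df p q r; have [S SP] := df (q, r).
apply: (sub_finite_set _ (finite_seq S)) => i /=.
apply: contraNT => iS; rewrite /ccomulr_term [tmap _ _ _]tlift0; last first.
  by move=> u v; have /= -> := SP _ iS v; rewrite pure0r.
by rewrite /tassoc tlift_at0.
Qed.

End Pairing.

(** * Linear maps and induction on the graded space A (x) B *)

Section GradedTensor.
Variables (K : fieldType) (A : vectType K) (B : int -> vectType K).
Local Notation L := (gtens A B).

Lemma gliftE (W : lmodType K) (f : A -> dsum B -> W) t (S : {fset int}) :
  (degrees t `<=` S)%fset ->
  glift f t = \sum_(i <- S) tlift (fun a (x : B i) => f a (homog x)) (t i).
Proof.
move=> tS; rewrite /glift; apply: fsbigTE => i iS.
rewrite (@degreesP _ _ t) ?tlift_at0 //; apply: contra iS; exact: fsubsetP.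
Qed.

Lemma glift_linear (W : lmodType K) (f : A -> dsum B -> W) : linear (glift f).
Proof.
move=> c s t; pose S := (degrees s `|` (degrees t `|` degrees (c *: s + t)%R))%fset.
rewrite !(@gliftE _ _ _ S).
- rewrite scaler_sumr -big_split; apply: eq_bigr => i _ /=; exact: tlift_linear.
all: by apply/fsubsetP => i it; rewrite !in_fsetU it ?orbT.
Qed.

Lemma glift_funP (W : lmodType K) c (f g h : A -> dsum B -> W) t :
  (forall a x, f a x = c *: g a x + h a x) ->
  glift f t = c *: glift g t + glift h t.
Proof.
move=> fE; rewrite !(gliftE _ (fsubset_refl (degrees t))).
rewrite scaler_sumr -big_split; apply: eq_bigr => i _ /=.
by apply: tlift_funP.
Qed.

Lemma glift_homog (W : lmodType K) (f : A -> dsum B -> W) i (t : L i) :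
  glift f (homog t) = tlift (fun a (x : B i) => f a (homog x)) t.
Proof.
rewrite (@gliftE _ _ _ [fset i]%fset) ?big_seq_fset1 ?homog_in //.
apply/fsubsetP => j; apply: contraTT; rewrite inE => ji.
rewrite in_fset_set; last exact: dsum_finite.
by rewrite notin_setE /= homog_out ?eqxx // eq_sym.
Qed.

Lemma gpureE (a : A) (x : dsum B) i : gpure a x i = a \ox x i.
Proof. by []. Qed.

Lemma homog_pure i (a : A) (x : B i) : homog (a \ox x : L i) = gpure a (homog x).
Proof.
apply: dsum_ext => j; case: (eqVneq i j) => [<-|ij].
  by rewrite gpureE !homog_in.
by rewrite gpureE !homog_out // pure0r.
Qed.

Lemma tliftZ (U V : vectType K) (W : lmodType K) c (f : U -> V -> W) t :
  tlift (fun u v => c *: f u v) t = c *: tlift f t.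
Proof.
rewrite -[RHS]addr0 -(@tlift0 _ U V W (fun _ _ => 0) t) //.
by apply: tlift_funP => u v; rewrite addr0.
Qed.

Lemma tens_sum (U V : vectType K) (t : tens U V) :
  t = \sum_i \sum_j t i j *: (bas i \ox bas j).
Proof.
suff E : id =1 tlift (fun (u : U) (v : V) => u \ox v) by exact: E.
apply: tens_ext => [//||u v]; first exact: tlift_linear.
by rewrite tlift_pure //; exact: pure_bilinear.
Qed.

(** An element is a finite sum of homogeneous components, each a combination of tensors of basis
    vectors. The case of 0 follows from the first clause, as -1 times a pure tensor plus itself. *)
Lemma gtens_ind (P : dsum L -> Prop) :
  (forall c s t, P s -> P t -> P (c *: s + t)) ->
  (forall a x, P (gpure a x)) -> forall t, P t.
Proof.
move=> Plin Pg t.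
have P0 : P 0.
  have <- : (-1) *: gpure 0 0 + gpure (0 : A) (0 : dsum B) = 0 by rewrite scaleN1r addNr.
  exact: Plin.
have PS I (r : seq I) (F : I -> dsum L) : (forall i, P (F i)) -> P (\sum_(i <- r) F i).
  by move=> PF; elim/big_rec: _ => // i s _ Ps; rewrite -[F i]scale1r; exact: Plin.
rewrite (dsum_homog t) (fsbigTE (degrees t)) => [|i it]; last first.
  by rewrite degreesP // homog0.
apply: (PS) => i; have hl := @homog_linear _ L i.
pose h : {linear L i -> dsum L} := HB.pack (@homog K L i)
  (GRing.isLinear.Build K (L i) (dsum L) *:%R (@homog K L i) hl).
rewrite -[homog _]/(h _) [t i]tens_sum linear_sum; apply: (PS) => k.
rewrite linear_sum; apply: (PS) => l; rewrite linearZ /= homog_pure.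
by rewrite -[X in P X]addr0; exact: Plin.
Qed.

Lemma form_ext (f g : dsum L -> K) : scalar f -> scalar g ->
  (forall a x, f (gpure a x) = g (gpure a x)) -> f =1 g.
Proof.
by move=> fl gl fg; apply: gtens_ind => // c s t fs ft; rewrite fl gl fs ft.
Qed.

(** Applied to one variable at a time, this reduces a multilinear scalar identity to pure
    tensors. *)
Lemma form_eq0 (f : dsum L -> K) : scalar f ->
  (forall a x, f (gpure a x) = 0) -> forall u, f u = 0.
Proof.
by move=> fl; apply: form_ext => // c u v; rewrite mulr0 addr0.
Qed.

End GradedTensor.

(** * The forms l (x) omega(-, y) separate points *)

Section Zinbiel.
Variables (K : fieldType) (A : vectType K) (B : int -> vectType K).
Variables (dia : dsum B -> dsum B -> dsum B) (omega : dsum B -> dsum B -> K).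
Hypothesis hB : quadratic_graded_zinbiel dia omega.
Local Notation L := (gtens A B).

(** The degree of omega is extracted by choice because types such as [B (- m - i)] are formed from
    it. *)
Let m : int := projT1 (cid (qz_omega_graded hB)).

Lemma omega_degree i j (x : B i) (y : B j) :
  i + j + m != 0 -> omega (homog x) (homog y) = 0.
Proof. exact: (projT2 (cid (qz_omega_graded hB))). Qed.

Lemma omegal y : scalar (omega^~ y).
Proof. by have [h _] := qz_omega_bilinear hB; move=> c u v; rewrite h. Qed.

Lemma omegar x : scalar (omega x).
Proof. by have [_ h] := qz_omega_bilinear hB; move=> c u v; rewrite h. Qed.

Lemma omega_continuous y : continuous_form (omega^~ y).
Proof.
split; first exact: omegal.
exists [fset (- m - j)%R | j in degrees y]%fset => i iS u.
rewrite (dsum_homog y) (fsbigTE (degrees y)) => [|j]; last first.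
  by move=> /degreesP ->; rewrite homog0.
rewrite (form_sum _ _ _ (omegar _)) big1_seq // => j /= jy.
apply: omega_degree; apply: contra iS => /eqP ij.
by apply/imfsetP; exists j => //=; apply/eqP; rewrite -subr_eq0 -ij; apply/eqP; ring.
Qed.

(* Invariance and skew-symmetry give omega (u v) t + omega (u t) v +         *)
(* omega (t u) v = 0; exchanging v and t yields omega (x w) z = omega (z w) x. *)
Lemma omega_mulx x w z : omega (dia x w) z = - omega x (dia z w).
Proof.
have sk := qz_skew hB; have inv := qz_invariant hB.
have cyc u v t : omega (dia u v) t = - omega (dia u t) v - omega (dia t u) v.
  by rewrite inv (formD (omegar _)) !(sk v).
rewrite (sk x) opprK; have e1 := cyc w x z; have e2 := cyc w z x.
have -> : omega (dia x w) z = - omega (dia w x) z - omega (dia w z) x by rewrite e2; ring.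
by rewrite e1; ring.
Qed.

Lemma omega_mulr x w z : omega (dia w x) z = omega x (dia w z) + omega x (dia z w).
Proof. by rewrite (qz_invariant hB) (formD (omegar _)). Qed.

(** By the grading u is orthogonal to every degree other than - m - i, so orthogonality to that one
    makes it orthogonal to all of B. *)
Lemma omega_homog_inj i (u : B i) :
  (forall y : B (- m - i), omega (homog u) (homog y) = 0) -> u = 0.
Proof.
move=> h; suff : homog u = 0 by move=> /(congr1 (dcomp^~ i)) /=; rewrite homog_in.
apply: (qz_nondegenerate hB) => y.
rewrite (dsum_homog y) (fsbigTE (degrees y)) => [|j]; last first.
  by move=> /degreesP ->; rewrite homog0.
rewrite (form_sum _ _ _ (omegar _)) big1_seq // => j /= _.
have [->|ij] := eqVneq j (- m - i); first exact: h.
apply: omega_degree; apply: contra ij => /eqP ij.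
by apply/eqP/subr0_eq; rewrite -ij; ring.
Qed.

(* Non-degeneracy makes the rows of the Gram matrix of omega on              *)
(* B i x B (- m - i) independent, so it has a right inverse.                 *)
Lemma omega_dual i (k : 'I_(dim (B i))) :
  exists y : B (- m - i), forall u : B i, omega (homog u) (homog y) = v2r u 0 k.
Proof.
pose j := - m - i.
pose G : 'M[K]_(dim (B i), dim (B j)) :=
  \matrix_(a, b) omega (homog (bas a)) (homog (bas b)).
have GE (u : B i) (y : B j) :
    omega (homog u) (homog y) = (v2r u *m G *m (v2r y)^T) 0 0.
  rewrite [in LHS](bas_sum u) [in LHS](bas_sum y).
  rewrite (form_sum _ _ _ (homog_scalar (omegal _))) -mulmxA mxE.
  apply: eq_bigr => a _; rewrite (formZ _ (homog_scalar (omegal _))); congr (_ * _).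
  rewrite (form_sum _ _ _ (homog_scalar (omegar _))) mxE.
  apply: eq_bigr => b _; rewrite (formZ _ (homog_scalar (omegar _))).
  by rewrite !mxE mulrC.
have /row_freeP[H GH] : row_free G.
  (* A row in the left kernel of G is the coordinate vector of an element of B i orthogonal to B j,
     hence zero. *)
  rewrite -kermx_eq0; apply/eqP/row_matrixP => a; rewrite row0.
  have : row a (kermx G) *m G = 0 by rewrite -row_mul mulmx_ker row0.
  move: (row a _) => r rG; apply: (can_inj r2vK); rewrite linear0.
  apply: omega_homog_inj => y; rewrite GE r2vK -/j rG mul0mx mxE //.
(* Pairing u with column k of the right inverse H gives entry k of u G H = u. *)
exists (r2v (col k H)^T) => u.
by rewrite GE r2vK trmxK colE -mulmxA (mulmxA G) GH mul1mx -colE mxE.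
Qed.

Lemma omega_hat_pairing T y1 y2 :
  omega_hat omega T y1 y2 = pairing (omega^~ y1) (omega^~ y2) T.
Proof. by []. Qed.

(* The form l (x) omega(-, y) on A (x) B. *)
Definition dform (l : A -> K) (y : dsum B) : dsum L -> K :=
  glift (W := K^o) (fun a x => l a * omega x y).

Lemma dform_scalar l y : scalar (dform l y).
Proof. by move=> c s t; rewrite /dform glift_linear. Qed.

Lemma dform_gpure l y a x : scalar l -> dform l y (gpure a x) = l a * omega x y.
Proof.
move=> ll; rewrite /dform glift_gpure //; split=> [z|b] c u v /=.
  by rewrite ll mulrDl -mulrA.
by rewrite (omegal y) mulrDr mulrCA.
Qed.

Lemma dform_homog l y i (t : L i) :
  dform l y (homog t) = ev2 l (fun x => omega (homog x) y) t.
Proof. exact: (@glift_homog _ _ _ K^o). Qed.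

Lemma dform_supported l y S : supported (omega^~ y) S -> supported (dform l y) S.
Proof. by move=> yS i iS u; rewrite dform_homog ev20r // => x; exact: yS. Qed.

Lemma dform_continuous l y : continuous_form (dform l y).
Proof.
split; first exact: dform_scalar.
have [_ [S yS]] := omega_continuous y; exists S; exact: dform_supported.
Qed.

(** In each pair of degrees the product forms split into a factor on A (x) A and a factor on B (x)
    B; the first is the same in all degrees and leaves the sum. *)
Lemma pairing_bullet l l' y y' s T : scalar l -> scalar l' ->
  pairing (dform l y) (dform l' y') (bullet s T) = ev2 l l' s * omega_hat omega T y y'.
Proof.
move=> ll ll'; rewrite omega_hat_pairing /pairing mulr_fsumr.
apply: eq_fsbigr => -[i j] _ /=.
rewrite (_ : (fun u : L i => _) = ev2 l (fun x => omega (homog x) y)); last first.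
  by apply/funext => u; exact: dform_homog.
rewrite (_ : (fun u : L j => _) = ev2 l' (fun x => omega (homog x) y')); last first.
  by apply/funext => u; exact: dform_homog.
have sy k z : scalar (fun x : B k => omega (homog x) z) := homog_scalar (omegal z).
rewrite /bullet (form_tlift _ _ (ev2_scalar _ _)) mulrC.
rewrite [ev2 l l' s]/ev2 -[RHS](tliftZ (W := K^o)); apply: (eq_tlift (W := K^o)) => a b.
rewrite (form_tlift _ _ (ev2_scalar _ _)) /GRing.scale /= mulrC [ev2 _ _ (T i j)]/ev2.
rewrite -[RHS](tliftZ (W := K^o)); apply: (eq_tlift (W := K^o)) => x x'.
rewrite !ev2_pure //; try exact: ev2_scalar; try exact: sy.
by rewrite /GRing.scale /=; ring.
Qed.

(** The products of coordinate forms are the basis dual to the tensors [bas i \ox bas j], so they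
    span all forms; the zero clause covers empty sums. *)
Lemma tens_form_ind (U V : vectType K) (Q : (tens U V -> K) -> Prop) :
  (forall c f g, Q f -> Q g -> Q (fun t => c * f t + g t)) ->
  (forall i j, Q (ev2 (fun u => v2r u 0 i) (fun v => v2r v 0 j))) ->
  Q (fun=> 0) -> forall f, scalar f -> Q f.
Proof.
move=> Qlin Qc Q0 f fl.
have QS I (r : seq I) (F : I -> tens U V -> K) :
    (forall i, Q (F i)) -> Q (fun t => \sum_(i <- r) F i t).
  move=> QF; elim: r => [|i r IH].
    by rewrite (_ : (fun t => _) = fun=> 0) //; apply/funext => t; rewrite big_nil.
  rewrite (_ : (fun t => _) = fun t => 1 * F i t + \sum_(i <- r) F i t); first exact: Qlin.
  by apply/funext => t; rewrite big_cons mul1r.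
rewrite (_ : f = fun t => \sum_i \sum_j (f (bas i \ox bas j) *
    ev2 (fun u => v2r u 0 i) (fun v => v2r v 0 j) t + 0)).
  by apply: (QS) => i; apply: (QS) => j; exact: Qlin.
apply/funext => t; rewrite {1}(tens_sum t) form_sum //.
apply: eq_bigr => i _; rewrite form_sum //; apply: eq_bigr => j _.
by rewrite formZ // ev2_coord addr0 mulrC.
Qed.

Lemma tens_eq0 (U V : vectType K) (t : tens U V) :
  (forall f g, scalar f -> scalar g -> ev2 f g t = 0) -> t = 0.
Proof.
by move=> h; apply/matrixP => a b; rewrite mxE -ev2_coord h //; exact: coord_scalar.
Qed.

(** In a fixed bidegree (p, q) it is enough to test with products of coordinate forms. By
    [omega_dual] their B-factors are omega(-, y) and omega(-, z) with y, z homogeneous; these see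
    only the degrees p and q, so the pairing collapses to that one component. *)
Lemma ctens2_eq0 (T : ctens2 L L) :
  (forall l l' y y', scalar l -> scalar l' ->
     pairing (dform l y) (dform l' y') T = 0) -> T = 0.
Proof.
move=> h; apply: functional_extensionality_dep => p.
apply: functional_extensionality_dep => q; apply: tens_eq0 => f g fl gl.
move: f fl; apply: tens_form_ind => [c f f' E E'|i j|]; last exact: ev20l.
  by rewrite ev2_linl E E' mulr0 addr0.
move: g gl; apply: tens_form_ind => [c f f' E E'|k l|]; last exact: ev20r.
  by rewrite ev2_linr E E' mulr0 addr0.
have [[y yE] [z zE]] := (omega_dual j, omega_dual l).
rewrite -[RHS](h _ _ (homog y) (homog z) (@coord_scalar _ A i) (@coord_scalar _ A k)).
have supp r (w : B (- m - r)) : supported (omega^~ (homog w)) [fset r]%fset.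
  move=> n; rewrite inE => nr u; apply: omega_degree; apply: contra nr => /eqP nr.
  by apply/eqP/subr0_eq; rewrite -nr; ring.
rewrite (pairingE _ (dform_supported _ (supp _ _)) (dform_supported _ (supp _ _))).
rewrite !big_seq_fset1; congr ev2; apply/funext => u; rewrite dform_homog.
  by congr ev2; apply/funext => b.
by congr ev2; apply/funext => b.
Qed.

Lemma ctens3_eq0 (T : ctens3 L L L) :
  (forall l1 l2 l3 y1 y2 y3 S1 S2 S3, scalar l1 -> scalar l2 -> scalar l3 ->
     supported (dform l1 y1) S1 -> supported (dform l2 y2) S2 ->
     supported (dform l3 y3) S3 ->
     pairing3 S1 S2 S3 (dform l1 y1) (dform l2 y2) (dform l3 y3) T = 0) -> T = 0.
Proof.
move=> H; apply: functional_extensionality_dep => p.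
apply: functional_extensionality_dep => q; apply: functional_extensionality_dep => r.
apply: tens_eq0 => f h fl hl; move: f fl.
apply: tens_form_ind => [c f f' E E'|i j|]; last exact: ev20l.
  by rewrite ev2_linl E E' mulr0 addr0.
(* L p and L q are tensor spaces themselves: their coordinate forms are generalized to arbitrary
   forms so that these can be decomposed again, into coordinate forms on A and on B. *)
have : scalar (fun u : L p => v2r u 0 i) := @coord_scalar _ _ i.
have : scalar (fun u : L q => v2r u 0 j) := @coord_scalar _ _ j.
move: (fun u : L p => _) (fun u : L q => _) => f g gl fl.
move: f fl; apply: tens_form_ind => [c f f' E E'|a b|].
- rewrite -(mulr0 c) -E -[RHS]addr0 -E' -ev2_linl; congr ev2; apply/funext => t.
  by rewrite ev2_linl.
- move: g gl; apply: tens_form_ind => [c f f' E E'|a' b'|].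
  + rewrite -(mulr0 c) -E -[RHS]addr0 -E' -ev2_linl; congr ev2; apply/funext => t.
    by rewrite ev2_linr.
  + move: h hl; apply: tens_form_ind => [c f f' E E'|a'' b''|]; last exact: ev20r.
      by rewrite ev2_linr E E' mulr0 addr0.
    have [[y yE] [[z zE] [w wE]]] := (omega_dual b, (omega_dual b', omega_dual b'')).
    have supp s (v : B (- m - s)) l : supported (dform l (homog v)) [fset s]%fset.
      apply: dform_supported => n; rewrite inE => ns u; apply: omega_degree.
      by apply: contra ns => /eqP ns; apply/eqP/subr0_eq; rewrite -ns; ring.
    rewrite -[RHS](H _ _ _ _ _ _ _ _ _ (@coord_scalar _ A a) (@coord_scalar _ A a')
      (@coord_scalar _ A a'') (supp _ y _) (supp _ z _) (supp _ w _)).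
    rewrite /pairing3 !big_seq_fset1; congr ev2; first congr ev2;
      by apply/funext => u; rewrite dform_homog; congr ev2; apply/funext => v.
  + by apply: ev20l => t; exact: ev20r.
- by apply: ev20l => t; exact: ev20l.
Qed.

(** The shift is m: for y of degree - m - p and z of degree - m - q, omega(x, y z) vanishes unless i
    + (- m - p) + (- m - q) + m = 0, that is i = p + q + m. *)
Lemma copairing_degree (eta : dsum B -> ctens2 B B) :
  (forall x y z, omega_hat omega (eta x) y z = - omega x (dia y z)) ->
  exists d : int, forall i (x : B i) p q, i != p + q + d -> eta (homog x) p q = 0.
Proof.
move=> eta_omega; exists m => i x p q ipq; apply/matrixP => k l; rewrite mxE -ev2_coord.
have [[y yE] [z zE]] := (omega_dual k, omega_dual l).
have supp r (w : B (- m - r)) : supported (omega^~ (homog w)) [fset r]%fset.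
  move=> n; rewrite inE => nr u; apply: omega_degree; apply: contra nr => /eqP nr.
  by apply/eqP/subr0_eq; rewrite -nr; ring.
have := eta_omega (homog x) (homog y) (homog z).
rewrite omega_hat_pairing (pairingE _ (supp _ _) (supp _ _)) !big_seq_fset1.
have [w ->] := qz_graded hB y z.
rewrite omega_degree ?oppr0 => [<-|].
  by congr ev2; apply/funext => u; rewrite ?yE ?zE.
by apply: contra ipq => /eqP e; apply/eqP/subr0_eq; rewrite -e; ring.
Qed.
End Zinbiel.

(** * Linear maps that extend termwise to completed tensors *)

Section LocallyFiniteMaps.
Variable K : fieldType.
Implicit Types U V W : int -> vectType K.

Definition continuous_map U V (F : dsum U -> dsum V) : Prop :=
  linear F /\ locally_finite (fun x => dcomp (F x)).

Lemma continuous_map_lin U V c (F G : dsum U -> dsum V) :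
  continuous_map F -> continuous_map G -> continuous_map (fun u => c *: F u + G u).
Proof.
move=> [Fl Ff] [Gl Gf]; split=> [d u v|p].
  by rewrite Fl Gl !scalerDr !scalerA mulrC addrACA.
have [[S SP] [S' S'P]] := (Ff p, Gf p); exists (S `|` S')%fset => i.
rewrite in_fsetU negb_or => /andP[iS iS'] u.
by rewrite dsumD dsumZ SP // S'P // scaler0 addr0.
Qed.

Lemma continuous_map_sub U V (F G : dsum U -> dsum V) :
  continuous_map F -> continuous_map G -> continuous_map (fun u => F u - G u).
Proof.
move=> Fc Gc; rewrite (_ : (fun u => _) = fun u => (-1) *: G u + F u).
  exact: continuous_map_lin.
by apply/funext => u; rewrite scaleN1r addrC.
Qed.

Lemma continuous_form_map U V (phi : dsum V -> K) (F : dsum U -> dsum V) :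
  continuous_form phi -> continuous_map F -> continuous_form (fun u => phi (F u)).
Proof. by move=> phic [Fl Ff]; exact: continuous_form_comp. Qed.

Lemma pairing_mapl U V W c (phi : dsum W -> K) (psi : dsum V -> K)
    (F G H : dsum U -> dsum W) T :
  continuous_form phi -> continuous_form psi -> continuous_map G -> continuous_map H ->
  (forall u, F u = c *: G u + H u) ->
  pairing (fun u => phi (F u)) psi T =
  c * pairing (fun u => phi (G u)) psi T + pairing (fun u => phi (H u)) psi T.
Proof.
move=> phic psic Gc Hc FE; have -> : (fun u => phi (F u)) = fun u => c * phi (G u) + phi (H u).
  by apply/funext => u; rewrite FE (phic.1).
by rewrite pairing_linl //; exact: continuous_form_map.
Qed.

Lemma pairing_mapr U V W c (phi : dsum V -> K) (psi : dsum W -> K)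
    (F G H : dsum U -> dsum W) T :
  continuous_form phi -> continuous_form psi -> continuous_map G -> continuous_map H ->
  (forall u, F u = c *: G u + H u) ->
  pairing phi (fun u => psi (F u)) T =
  c * pairing phi (fun u => psi (G u)) T + pairing phi (fun u => psi (H u)) T.
Proof.
move=> phic psic Gc Hc FE; have -> : (fun u => psi (F u)) = fun u => c * psi (G u) + psi (H u).
  by apply/funext => u; rewrite FE (psic.1).
by rewrite pairing_linr //; exact: continuous_form_map.
Qed.

End LocallyFiniteMaps.

(** * The pre-Lie product on A (x) B *)

Section TensorProduct.
Variables (K : fieldType) (A : vectType K) (succ prec : A -> A -> A).
Variables (B : int -> vectType K) (dia : dsum B -> dsum B -> dsum B).
Hypotheses (succ_bilinear : bilinear_map succ) (prec_bilinear : bilinear_map prec).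
Hypothesis dia_bilinear : bilinear_map dia.
Hypothesis dia_graded : forall i j (x : B i) (y : B j),
  exists z : B (i + j), dia (homog x) (homog y) = homog z.
Local Notation L := (gtens A B).
Local Notation mul := (tensor_mul succ prec dia).

Lemma tensor_mul_linearr s : linear (mul s).
Proof.
move=> c u v; rewrite /tensor_mul; apply: glift_funP => a x; exact: glift_linear.
Qed.

Lemma tensor_mul_linearl t : linear (mul^~ t).
Proof. by move=> c u v; rewrite /tensor_mul glift_linear. Qed.

(** With j running over the finitely many degrees of x, only the degrees i = p - j can contribute to
    degree p of a product with x, on either side. *)
Lemma dia_degree x p : exists S : {fset int}, forall i, i \notin S -> forall u : B i,
  dia x (homog u) p = 0 /\ dia (homog u) x p = 0.
Proof.
have [dl dr] := dia_bilinear.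
exists [fset (p - j)%R | j in degrees x]%fset => i iS u.
have hp (f : dsum B -> dsum B) : linear f ->
    (forall j, i + j != p -> f (homog (x j)) p = 0) -> f x p = 0.
  move=> fl fj; pose f' : {linear dsum B -> dsum B} :=
    HB.pack f (GRing.isLinear.Build K (dsum B) (dsum B) *:%R f fl).
  rewrite (dsum_homog x) (fsbigTE (degrees x)) => [|j]; last first.
    by move=> /degreesP ->; rewrite homog0.
  rewrite -[f _]/(f' _) linear_sum dsum_sumE big1_seq // => j /= jx.
  apply: fj; apply: contra iS => /eqP ij; apply/imfsetP; exists j => //=.
  by rewrite -ij addrK.
split; [apply: (hp (dia^~ _)) => // j ij|apply: (hp (dia _)) => // j ij].
  by have [z ->] := dia_graded (x j) u; rewrite homog_out // addrC.
by have [z ->] := dia_graded u (x j); rewrite homog_out.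
Qed.

Lemma dsumB (V : int -> vectType K) (u v : dsum V) i : (u - v) i = u i - v i.
Proof. by []. Qed.

Lemma tensor_mul_gpure_degree a x p : exists S : {fset int}, forall i, i \notin S ->
  forall u : L i, mul (gpure a x) (homog u) p = 0 /\ mul (homog u) (gpure a x) p = 0.
Proof.
have [S SP] := dia_degree x p; exists S => i iS u.
split; move: u.
  apply: (@tens_ext _ _ _ (L p) _ (fun=> 0)) => [c u v|c u v|b z].
  - by rewrite homog_linear tensor_mul_linearr dsumD dsumZ.
  - by rewrite scaler0 addr0.
  by rewrite homog_pure tensor_mulE // dsumB !gpureE (SP _ iS z).1 (SP _ iS z).2 !pure0r subr0.
apply: (@tens_ext _ _ _ (L p) _ (fun=> 0)) => [c u v|c u v|b z].
- by rewrite homog_linear tensor_mul_linearl dsumD dsumZ.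
- by rewrite scaler0 addr0.
by rewrite homog_pure tensor_mulE // dsumB !gpureE (SP _ iS z).1 (SP _ iS z).2 !pure0r subr0.
Qed.

Lemma tensor_mulr_continuous s : continuous_map (mul s).
Proof.
move: s; apply: gtens_ind => [c s t sc tc|a x].
  rewrite (_ : mul _ = fun u => c *: mul s u + mul t u); first exact: continuous_map_lin.
  by apply/funext => u; exact: tensor_mul_linearl.
split=> [|p]; first exact: tensor_mul_linearr.
have [S SP] := tensor_mul_gpure_degree a x p; exists S => i iS u.
by case: (SP _ iS u).
Qed.

Lemma tensor_mull_continuous s : continuous_map (mul^~ s).
Proof.
move: s; apply: gtens_ind => [c s t sc tc|a x].
  rewrite (_ : mul^~ _ = fun u => c *: mul u s + mul u t); first exact: continuous_map_lin.
  by apply/funext => u; exact: tensor_mul_linearr.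
split=> [|p]; first exact: tensor_mul_linearl.
have [S SP] := tensor_mul_gpure_degree a x p; exists S => i iS u.
by case: (SP _ iS u).
Qed.

(** Entries separate the points of the direct sum. They are the test forms for the pre-Lie identity,
    which lives in A (x) B and not in a completed tensor power. *)
Lemma homog_entry_form i k l : scalar (fun u : dsum L => u i k l).
Proof. by move=> c u v; rewrite dsumD dsumZ !mxE. Qed.

Lemma tensor_mulBl s t u : mul (s - t) u = mul s u - mul t u.
Proof. by rewrite -scaleN1r addrC tensor_mul_linearl scaleN1r addrC. Qed.

Lemma tensor_mulBr s t u : mul u (s - t) = mul u s - mul u t.
Proof. by rewrite -scaleN1r addrC tensor_mul_linearr scaleN1r addrC. Qed.

Lemma tensor_prelie :
  leibniz_dendriform_algebra succ prec ->
  (forall x y z, dia x (dia y z) = dia (dia x y) z + dia (dia y x) z) ->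
  prelie_algebra mul.
Proof.
move=> hA zin; split=> [|X Y Z]; first by split; [exact: tensor_mul_linearl|exact: tensor_mul_linearr].
pose E X Y Z := mul (mul X Y) Z - mul X (mul Y Z) - (mul (mul Y X) Z - mul Y (mul X Z)).
suff E0 : E X Y Z = 0 by apply/subr0_eq.
have tr1 := tensor_mul_linearl; have tr2 := tensor_mul_linearr.
apply: dsum_ext => i; apply/matrixP => k l.
pose e (u : dsum L) := u i k l; have el : scalar e := @homog_entry_form i k l.
suff h : forall X Y Z, e (E X Y Z) = 0.
  by rewrite -[LHS]/(e _) h -[RHS]/(e 0) (form0 el).
have eE X' Y' Z' : e (E X' Y' Z') = e (mul (mul X' Y') Z') - e (mul X' (mul Y' Z'))
   - (e (mul (mul Y' X') Z') - e (mul Y' (mul X' Z'))) by rewrite /E !(formB el).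
move=> {X Y Z} X Y Z; rewrite eE; move: X; apply: form_eq0 => [|a x].
  by scalar_tac => c s t; rewrite !(tr1, tr2, el).
move: Y; apply: form_eq0 => [|b y].
  by scalar_tac => c s t; rewrite !(tr1, tr2, el).
move: Z; apply: form_eq0 => [|d z].
  by scalar_tac => c s t; rewrite !(tr1, tr2, el).
(* On pure tensors the entry form is the product of a coordinate form on A and one on B. *)
pose al (a : A) := v2r a 0 k; pose be (x : dsum B) := v2r (x i) 0 l.
have eg a' x' : e (gpure a' x') = al a' * be x' by rewrite /e gpureE pureE.
have all : scalar al by exact: coord_scalar.
have bel : scalar be by move=> c u v; rewrite /be dsumD dsumZ; exact: coord_scalar.
rewrite !(tensor_mulE, tensor_mulBl, tensor_mulBr) // !(formB el) !eg.
have bz u v w : be (dia u (dia v w)) = be (dia (dia u v) w) + be (dia (dia v u) w).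
  by rewrite zin (formD bel).
rewrite !bz; have [[sl sr] [pl pr]] := (succ_bilinear, prec_bilinear).
have sDl u v w : succ (u + v) w = succ u w + succ v w by have := sl w 1 u v; rewrite /= !scale1r.
have pDr u v w : prec w (u + v) = prec w u + prec w v by have := pr w 1 u v; rewrite /= !scale1r.
(* A word in x, y, z with z in third, second or first place receives an instance of h1, h2 or h3
   respectively, whose arguments a, b, d follow the order of the letters x, y, z in the word. *)
have h1 u v w : al (succ (succ u v) w) + al (succ (prec u v) w)
    - (al (succ u (succ v w)) - al (succ v (succ u w))) = 0.
  by rewrite -(formD all) -sDl (lda_circ_succ hA) (formB all) subrr.
have h2 u v w : al (prec v (succ u w)) + al (prec v (prec u w))
    + al (prec (succ u v) w) - al (succ u (prec v w)) = 0.
  by rewrite -(formD all) -pDr -(formD all) (lda_succ_prec hA) subrr.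
have h3 u v w : al (prec u (succ v w)) + al (prec u (prec v w))
    - (al (prec (prec u v) w) + al (succ v (prec u w))) = 0.
  by rewrite -(formD all) -pDr (lda_prec_circ hA) (formD all) subrr.
(* Each 0 below is rewritten, from left to right, into an instance of an axiom. *)
transitivity (
    be (dia (dia x y) z) * 0 - be (dia (dia z x) y) * 0 - be (dia (dia x z) y) * 0
  - be (dia (dia y x) z) * 0 + be (dia (dia z y) x) * 0 + be (dia (dia y z) x) * 0);
  last by ring.
rewrite -{1}(h1 a b d) -{1}(h3 d a b) -{1}(h2 a d b) -{1}(h1 b a d) -{1}(h3 d b a) -{1}(h2 b d a).
by ring.
Qed.
End TensorProduct.

(** * The bialgebra axioms under the pairing *)

Section Contraction.
Variables (K : fieldType) (A : vectType K) (succ prec : A -> A -> A).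
Variables (Ds Dp : A -> tens A A).
Hypothesis hA : leibniz_dendriform_bialgebra succ prec Ds Dp.
Variables (B : int -> vectType K) (dia : dsum B -> dsum B -> dsum B).
Variable omega : dsum B -> dsum B -> K.
Hypothesis hB : quadratic_graded_zinbiel dia omega.
Variable eta : dsum B -> ctens2 B B.
Hypothesis eta_linear : linear eta.
Hypothesis eta_omega : forall b1 b2 b3 : dsum B,
  omega_hat omega (eta b1) b2 b3 = - omega b1 (dia b2 b3).

Local Notation L := (gtens A B).
Local Notation mul := (tensor_mul succ prec dia).
Local Notation delta := (tensor_comul Ds Dp eta).
Local Notation form := (@dform K A B omega).

Let succ_bl : bilinear_map succ := lda_succ_bilinear (ldb_algebra hA).
Let prec_bl : bilinear_map prec := lda_prec_bilinear (ldb_algebra hA).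
Let dia_bl : bilinear_map dia := qz_dia_bilinear hB.
Let Ds_linear : linear Ds := ldc_succ_linear (ldb_coalgebra hA).
Let Dp_linear : linear Dp := ldc_prec_linear (ldb_coalgebra hA).

Let gpure_mul a x b y : mul (gpure a x) (gpure b y) =
  gpure (succ a b) (dia x y) - gpure (prec b a) (dia y x).
Proof. exact: tensor_mulE. Qed.

Lemma form_succl l a : scalar l -> scalar (fun b => l (succ a b)).
Proof. by move=> ll c u v; rewrite (succ_bl.2 a) ll. Qed.
Lemma form_succr l b : scalar l -> scalar (fun a => l (succ a b)).
Proof. by move=> ll c u v; have /= -> := succ_bl.1 b; rewrite ll. Qed.
Lemma form_precl l a : scalar l -> scalar (fun b => l (prec a b)).
Proof. by move=> ll c u v; rewrite (prec_bl.2 a) ll. Qed.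
Lemma form_precr l b : scalar l -> scalar (fun a => l (prec a b)).
Proof. by move=> ll c u v; have /= -> := prec_bl.1 b; rewrite ll. Qed.
Lemma form_Ds l l' : scalar (fun a => ev2 l l' (Ds a)).
Proof. by move=> c u v; rewrite Ds_linear ev2_scalar. Qed.
Lemma form_Dp l l' : scalar (fun a => ev2 l l' (Dp a)).
Proof. by move=> c u v; rewrite Dp_linear ev2_scalar. Qed.

Ltac form_tac := first [done | exact: form_succl | exact: form_succr | exact: form_precl
  | exact: form_precr | exact: form_Ds | exact: form_Dp].

(** The transposition rests on omega(x z, y) = omega(z, x y + y x), which is invariance, and omega(z
    x, y) = - omega(z, y x), which is [omega_mulx]; [dform_mull] uses the same two rules with the
    factors exchanged. *)
Lemma dform_mulr l y a x u : scalar l ->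
  form l y (mul (gpure a x) u) =
  form (fun b => l (succ a b)) (dia x y + dia y x) u +
  form (fun b => l (prec b a)) (dia y x) u.
Proof.
move=> ll; move: u; apply: form_ext => [c u v|c u v|b z].
- by rewrite tensor_mul_linearr dform_scalar.
- by rewrite !dform_scalar; ring.
rewrite gpure_mul (formB (dform_scalar _ _ _)) !(dform_gpure hB); try form_tac.
rewrite (qz_invariant hB) (omega_mulx hB z); ring.
Qed.

Lemma dform_mull l y b z u : scalar l ->
  form l y (mul u (gpure b z)) =
  - form (fun a => l (succ a b)) (dia y z) u -
  form (fun a => l (prec b a)) (dia z y + dia y z) u.
Proof.
move=> ll; move: u; apply: form_ext => [c u v|c u v|a x].
- by rewrite tensor_mul_linearl dform_scalar.
- by rewrite !dform_scalar; ring.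
rewrite gpure_mul (formB (dform_scalar _ _ _)) !(dform_gpure hB); try form_tac.
rewrite (omega_mulx hB x) (qz_invariant hB z); ring.
Qed.

Lemma delta_linear : linear delta.
Proof. exact: glift_linear. Qed.

Lemma omega_hat_flip T y y' : omega_hat omega (cflip T) y y' = omega_hat omega T y' y.
Proof. exact: (pairing_flip T (omega_continuous hB _) (omega_continuous hB _)). Qed.

Lemma pairing_delta l l' y y' a x : scalar l -> scalar l' ->
  pairing (form l y) (form l' y') (delta (gpure a x)) =
  - omega x (dia y y') * ev2 l l' (Ds a) + omega x (dia y' y) * ev2 l' l (Dp a).
Proof.
move=> ll ll'; rewrite tensor_comulE //.
rewrite (formB (pairing_scalar (dform_continuous hB _ _) (dform_continuous hB _ _))).
rewrite !(pairing_bullet hB) // omega_hat_flip !eta_omega ev2_tflip //; ring.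
Qed.

(** By homogeneity of eta only one degree reaches (p, q). It depends on p + q alone, so the flipped
    summand of delta obeys the same bound. *)
Lemma delta_locally_finite :
  locally_finite (W := fun pq : int * int => tens (L pq.1) (L pq.2) : lmodType K)
    (fun x pq => delta x pq.1 pq.2).
Proof.
have [m mP] := copairing_degree hB eta_omega.
move=> [p q]; exists [fset (p + q + m)%R]%fset => i; rewrite inE => ipq.
apply: (@tens_ext _ _ _ (tens (L p) (L q)) _ (fun=> 0)) => [c u v|c u v|b z] /=.
- by rewrite homog_linear delta_linear.
- by rewrite scaler0 addr0.
rewrite homog_pure tensor_comulE //.
rewrite -[LHS]/(bullet _ _ p q - bullet _ _ p q) /bullet /cflip.
rewrite mP // mP; last by rewrite (addrC q).
have flip0 (U V : vectType K) : @tflip K U V 0 = 0 by exact: tlift_at0.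
by rewrite flip0 !tlift0 ?subr0 // => u v; exact: tlift_at0.
Qed.

Let evD (U V : vectType K) (f : U -> K) (g : V -> K) := formD (ev2_scalar f g).
Let evB (U V : vectType K) (f : U -> K) (g : V -> K) := formB (ev2_scalar f g).

Lemma ev2_flip_left l m n (t : tens (tens A A) A) :
  scalar l -> scalar m -> scalar n ->
  ev2 (ev2 l m) n (tmap (@tflip _ _ _) id t) = ev2 (ev2 m l) n t.
Proof.
move=> ll ml nl; rewrite ev2_tmapl //; last exact: ev2_scalar.
by congr ev2; apply/funext => u; rewrite ev2_tflip.
Qed.

(** * The coalgebra axioms contracted with three forms *)

Section Coalgebra.
Variables (l m n : A -> K).
Hypotheses (ll : scalar l) (ml : scalar m) (nl : scalar n).

(** In all the [contract_] lemmas sums are expanded so that [ring] sees each contraction as an atom,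
    and everything stands on one side so that the axiom can later be substituted for a 0. *)
Lemma contract_circ_succ a :
  ev2 (fun u => ev2 l m (Ds u)) n (Ds a) + ev2 (fun u => ev2 l m (Dp u)) n (Ds a)
  - ev2 l (fun u => ev2 m n (Ds u)) (Ds a) + ev2 m (fun u => ev2 l n (Ds u)) (Ds a) = 0.
Proof.
have := congr1 (ev2 (ev2 l m) n) (ldc_circ_succ (ldb_coalgebra hA) a).
rewrite evB ev2_flip_left // !ev2_tassoc // ev2_tmaplD; [|exact: ev2_scalar|done].
by rewrite !ev2_tmapr //; try exact: ev2_scalar; move=> ->; ring.
Qed.

Lemma contract_succ_prec a :
  ev2 l (fun u => ev2 m n (Dp u)) (Ds a) - ev2 (fun u => ev2 l m (Ds u)) n (Dp a)
  - ev2 m (fun u => ev2 l n (Ds u)) (Dp a) - ev2 m (fun u => ev2 l n (Dp u)) (Dp a) = 0.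
Proof.
have := congr1 (ev2 (ev2 l m) n) (ldc_succ_prec (ldb_coalgebra hA) a).
rewrite evB ev2_flip_left // !ev2_tassoc // ev2_tmaprD; [|done|exact: ev2_scalar].
by rewrite ev2_tmapr ?ev2_tmapl //; try exact: ev2_scalar; move=> ->; ring.
Qed.

Lemma contract_prec_circ a :
  ev2 l (fun u => ev2 m n (Ds u)) (Dp a) + ev2 l (fun u => ev2 m n (Dp u)) (Dp a)
  - ev2 (fun u => ev2 l m (Dp u)) n (Dp a) - ev2 m (fun u => ev2 l n (Dp u)) (Ds a) = 0.
Proof.
have := congr1 (ev2 (ev2 l m) n) (ldc_prec_circ (ldb_coalgebra hA) a).
rewrite evD ev2_flip_left // !ev2_tassoc // ev2_tmaprD; [|done|exact: ev2_scalar].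
by rewrite ev2_tmapr ?ev2_tmapl //; try exact: ev2_scalar; move=> ->; ring.
Qed.
End Coalgebra.

(** * The compatibility axioms contracted with two forms *)

Section Bialgebra.
Variables (l m : A -> K) (x y : A).
Hypotheses (ll : scalar l) (ml : scalar m).

Let DsD u v : Ds (u + v) = Ds u + Ds v.
Proof. by have := Ds_linear 1 u v; rewrite !scale1r. Qed.
Let DpD u v : Dp (u + v) = Dp u + Dp v.
Proof. by have := Dp_linear 1 u v; rewrite !scale1r. Qed.

Lemma contract_odot :
  ev2 l m (Ds (succ x y)) + ev2 l m (Ds (prec y x))
  + ev2 l m (Dp (succ x y)) + ev2 l m (Dp (prec y x))
  - ev2 l (fun u => m (succ x u)) (Ds y) - ev2 l (fun u => m (succ x u)) (Dp y)
  - ev2 l (fun u => m (prec u x)) (Ds y) - ev2 l (fun u => m (prec u x)) (Dp y)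
  + ev2 m (fun u => l (succ x u)) (Ds y) + ev2 m (fun u => l (succ x u)) (Dp y)
  + ev2 m (fun u => l (prec u x)) (Ds y) + ev2 m (fun u => l (prec u x)) (Dp y)
  + ev2 m (fun u => l (succ u y)) (Ds x) + ev2 m (fun u => l (prec y u)) (Ds x)
  - ev2 l (fun u => m (succ u y)) (Ds x) - ev2 l (fun u => m (prec y u)) (Ds x) = 0.
Proof.
have := congr1 (ev2 l m) (ldb_odot hA x y).
rewrite [RHS](form0 (ev2_scalar _ _)) /= => <-.
rewrite !(DsD, DpD, evB, evD) !ev2_tflip // !ev2_tmaprD // !evD; ring.
Qed.

Lemma contract_succ :
  ev2 l m (Ds (succ x y)) + ev2 l m (Dp (succ x y))
  - ev2 (fun u => l (succ x u)) m (Ds y) - ev2 (fun u => l (succ x u)) m (Dp y)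
  - ev2 l (fun u => m (succ x u)) (Ds y) - ev2 l (fun u => m (succ x u)) (Dp y)
  - ev2 l (fun u => m (succ u y)) (Ds x) - ev2 (fun u => m (succ u y)) l (Dp x)
  + ev2 m (fun u => l (succ u y)) (Ds x) + ev2 m (fun u => l (prec y u)) (Ds x)
  + ev2 (fun u => l (succ u y)) m (Dp x) + ev2 (fun u => l (prec y u)) m (Dp x) = 0.
Proof.
have := congr1 (ev2 l m) (ldb_succ hA x y).
rewrite [RHS](form0 (ev2_scalar _ _)) /= => <-.
rewrite !(evB, evD) ev2_tflip // ev2_tmaprD // !ev2_tmapr // ev2_tmapl // !evD.
rewrite !ev2_tflip; try form_tac; ring.
Qed.

Lemma contract_mixed :
  ev2 (fun u => m (succ u y)) l (Dp x)
  - ev2 (fun u => l (prec u x)) m (Ds y) - ev2 (fun u => l (prec u x)) m (Dp y) = 0.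
Proof.
have := congr1 (ev2 l m) (ldb_mixed hA x y).
rewrite [RHS](form0 (ev2_scalar _ _)) /= => <-.
rewrite !(evB, evD) !ev2_tmapr // ev2_tmapl // !evD !ev2_tflip; try form_tac; ring.
Qed.

Lemma contract_Dodot_circ :
  ev2 l m (Ds (succ x y)) + ev2 l m (Ds (prec x y))
  + ev2 m l (Dp (succ x y)) + ev2 m l (Dp (prec x y))
  - ev2 l (fun u => m (succ x u)) (Ds y) - ev2 (fun u => m (succ x u)) l (Dp y)
  - ev2 l (fun u => m (prec x u)) (Ds y) - ev2 (fun u => m (prec x u)) l (Dp y)
  - ev2 (fun u => l (succ x u)) m (Ds y) - ev2 m (fun u => l (succ x u)) (Dp y)
  + ev2 l (fun u => m (succ y u)) (Ds x) + ev2 (fun u => m (succ y u)) l (Dp x)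
  + ev2 l (fun u => m (prec y u)) (Ds x) + ev2 (fun u => m (prec y u)) l (Dp x)
  + ev2 (fun u => l (succ y u)) m (Ds x) + ev2 m (fun u => l (succ y u)) (Dp x) = 0.
Proof.
have := congr1 (ev2 l m) (ldb_Dodot_circ hA x y).
rewrite [RHS](form0 (ev2_scalar _ _)) /= => <-.
rewrite !(DsD, DpD, evB, evD) !ev2_tmaprD // !ev2_tmapl // !evD.
rewrite !ev2_tflip ?evD; try form_tac; ring.
Qed.

Lemma contract_Dsucc_circ :
  ev2 l m (Ds (succ x y)) + ev2 l m (Ds (prec x y))
  - ev2 l (fun u => m (succ u y)) (Ds x) - ev2 l (fun u => m (prec u y)) (Ds x)
  - ev2 l (fun u => m (succ x u)) (Ds y) - ev2 l (fun u => m (prec x u)) (Ds y)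
  - ev2 (fun u => l (succ x u)) m (Ds y) - ev2 (fun u => l (prec u x)) m (Ds y)
  + ev2 (fun u => l (succ y u)) m (Ds x) + ev2 (fun u => l (prec u y)) m (Ds x)
  + ev2 m (fun u => l (succ y u)) (Dp x) + ev2 m (fun u => l (prec u y)) (Dp x) = 0.
Proof.
have := congr1 (ev2 l m) (ldb_Dsucc_circ hA x y).
rewrite [RHS](form0 (ev2_scalar _ _)) /= => <-.
rewrite !(DsD, evB, evD) !ev2_tmaprD // !ev2_tmaplD // !evD.
rewrite !ev2_tflip; try form_tac; ring.
Qed.

Lemma contract_mixed_circ :
  ev2 (fun u => m (succ u y)) l (Dp x) + ev2 (fun u => m (prec u y)) l (Dp x)
  - ev2 (fun u => l (prec u x)) m (Ds y) = 0.
Proof.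
have := congr1 (ev2 l m) (ldb_mixed_circ hA x y).
rewrite [RHS](form0 (ev2_scalar _ _)) /= => <-.
rewrite evB ev2_tmaprD // ev2_tmapl // !ev2_tflip; try form_tac; ring.
Qed.
End Bialgebra.

Let form_c l y : continuous_form (form l y) := dform_continuous hB l y.

Let delta_lf := delta_locally_finite.

Let diaDl u v w : dia (u + v) w = dia u w + dia v w.
Proof. by have := dia_bl.1 w 1 u v; rewrite /= !scale1r. Qed.
Let diaDr u v w : dia w (u + v) = dia w u + dia w v.
Proof. by have := dia_bl.2 w 1 u v; rewrite /= !scale1r. Qed.

(** Pulling product forms back along delta gives combinations of product forms again, so iterated
    comultiplications can be evaluated. The factor -1 fits the shape of [pairing_linl] and
    [pairing_linr]. *)
Lemma pairing_delta_form l l' y y' u : scalar l -> scalar l' ->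
  pairing (form l y) (form l' y') (delta u) =
  -1 * form (fun a => ev2 l l' (Ds a)) (dia y y') u +
  form (fun a => ev2 l' l (Dp a)) (dia y' y) u.
Proof.
move=> ll ll'; move: u; apply: form_ext => [c u v|c u v|a x].
- rewrite delta_linear; exact: (pairing_scalar (form_c _ _) (form_c _ _)).
- by rewrite !dform_scalar; ring.
rewrite pairing_delta // !(dform_gpure hB); try form_tac; ring.
Qed.

Lemma tensor_coalgebra : completed_prelie_coalgebra delta.
Proof.
split=> [|x|x|x]; [exact: delta_linear|exact: ccomull_def_lf|exact: ccomulr_def_lf|].
apply/subr0_eq; apply: (ctens3_eq0 hB) => l m n p q r S1 S2 S3 ll ml nl lS mS nS.
have fs := @dform_scalar K A B omega.
rewrite !(formB (pairing3_scalar _ _ _ _ _ _)) !pairing3_flip //.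
rewrite !(pairing3_ccomulr delta_lf) // !(pairing3_ccomull delta_lf) //.
have inner l1 l2 y1 y2 : scalar l1 -> scalar l2 ->
    (fun u => pairing (form l1 y1) (form l2 y2) (delta u)) =
    (fun u => -1 * form (fun a => ev2 l1 l2 (Ds a)) (dia y1 y2) u +
       form (fun a => ev2 l2 l1 (Dp a)) (dia y2 y1) u).
  by move=> h1 h2; apply/funext => u; exact: pairing_delta_form.
rewrite !inner //.
rewrite !(pairing_linl _ _ (form_c _ _) (form_c _ _) (form_c _ _)).
rewrite !(pairing_linr _ _ (form_c _ _) (form_c _ _) (form_c _ _)).
have dl l1 l2 y1 y2 : scalar (fun u => pairing (form l1 y1) (form l2 y2) (delta u)).
  by move=> c u v; rewrite delta_linear (pairing_scalar (form_c _ _) (form_c _ _)).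
move: x; apply: form_eq0 => [|a x]; first by scalar_tac; exact: dl.
rewrite !pairing_delta; try form_tac.
rewrite !(qz_zinbiel hB) !(formD (omegar hB x)).
(* A word in p, q, r with r in third, second or first place receives C1, C2 or C3 respectively, with
   l, m, n in the order of the letters p, q, r in the word: the dual of the pattern in
   [tensor_prelie]. *)
have C1 := contract_circ_succ; have C2 := contract_succ_prec.
have C3 := contract_prec_circ.
(* Each 0 below is rewritten, from left to right, into an instance of a         *)
(* coalgebra axiom; its factor is a multilinear word of the free Zinbiel algebra. *)
transitivity (- omega x (dia (dia p q) r) * 0 + omega x (dia (dia q p) r) * 0
  + omega x (dia (dia q r) p) * 0 - omega x (dia (dia p r) q) * 0
  + omega x (dia (dia r p) q) * 0 - omega x (dia (dia r q) p) * 0); last by ring.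
rewrite -{1}(C1 l m n ll ml nl a) -{1}(C1 m l n ml ll nl a) -{1}(C2 m n l ml nl ll a).
rewrite -{1}(C2 l n m ll nl ml a) -{1}(C3 n l m nl ll ml a) -{1}(C3 n m l nl ml ll a).
by ring.
Qed.

Let mulr_c s : continuous_map (mul s).
Proof. exact: (tensor_mulr_continuous succ_bl prec_bl dia_bl (qz_graded hB)). Qed.
Let mull_c s : continuous_map (mul^~ s).
Proof. exact: (tensor_mull_continuous succ_bl prec_bl dia_bl (qz_graded hB)). Qed.

(** * Transposed multiplications in either slot of a pairing *)

Section Slots.
Variables (U : int -> vectType K) (psi : dsum U -> K).
Hypothesis psi_c : continuous_form psi.

Let form0_c : continuous_form (fun _ : dsum L => 0 : K).
Proof. by split=> [c u v|]; [ring|exists fset0]. Qed.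

Let pairing_comb c c' (phi phi' : dsum L -> K) (T : ctens2 L U) :
  continuous_form phi -> continuous_form phi' ->
  pairing (fun u => c * phi u + c' * phi' u) psi T =
  c * pairing phi psi T + c' * pairing phi' psi T.
Proof.
move=> h h'; have pairing0 : pairing (fun _ : dsum L => 0 : K) psi T = 0.
  by rewrite /pairing fsbig1 // => ij _; exact: ev20l.
(* [pairing_linl] leaves its second form unscaled; appending a zero form lets it apply twice. *)
rewrite (_ : (fun u => _) = fun u => c * phi u + (c' * phi' u + 0)); last first.
  by apply/funext => u; ring.
rewrite pairing_linl // ?pairing_linl ?pairing0 ?addr0 //.
split=> [d u v|]; first by rewrite h'.1; ring.
by have [_ [S SP]] := h'; exists S => i iS u; rewrite SP // mulr0 addr0.
Qed.

(** In the suffixes of these names the first letter is the side of the variable factor in the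
    product, the second the slot of the pairing. *)
Lemma pairing_mulrl l y a x T : scalar l ->
  pairing (fun u => form l y (mul (gpure a x) u)) psi T =
  pairing (form (fun b => l (succ a b)) (dia x y + dia y x)) psi T +
  pairing (form (fun b => l (prec b a)) (dia y x)) psi T.
Proof.
move=> ll; have -> : (fun u => form l y (mul (gpure a x) u)) =
    fun u => 1 * form (fun b => l (succ a b)) (dia x y + dia y x) u +
      1 * form (fun b => l (prec b a)) (dia y x) u.
  by apply/funext => u; rewrite dform_mulr // !mul1r.
by rewrite (pairing_comb _ _ _ (form_c _ _) (form_c _ _)) !mul1r.
Qed.

Lemma pairing_mulll l y b z T : scalar l ->
  pairing (fun u => form l y (mul u (gpure b z))) psi T =
  - pairing (form (fun a => l (succ a b)) (dia y z)) psi T -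
  pairing (form (fun a => l (prec b a)) (dia z y + dia y z)) psi T.
Proof.
move=> ll; have -> : (fun u => form l y (mul u (gpure b z))) =
    fun u => -1 * form (fun a => l (succ a b)) (dia y z) u +
      -1 * form (fun a => l (prec b a)) (dia z y + dia y z) u.
  by apply/funext => u; rewrite dform_mull // !mulN1r.
by rewrite (pairing_comb _ _ _ (form_c _ _) (form_c _ _)) !mulN1r.
Qed.

(** The right slot is the left slot of the flipped tensor. *)
Lemma pairing_mulrr l y a x T : scalar l ->
  pairing psi (fun u => form l y (mul (gpure a x) u)) T =
  pairing psi (form (fun b => l (succ a b)) (dia x y + dia y x)) T +
  pairing psi (form (fun b => l (prec b a)) (dia y x)) T.
Proof.
move=> ll; rewrite -pairing_flip //; last by apply: continuous_form_map; [exact: form_c|exact: mulr_c].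
rewrite pairing_mulrl // !pairing_flip //; exact: form_c.
Qed.

Lemma pairing_mullr l y b z T : scalar l ->
  pairing psi (fun u => form l y (mul u (gpure b z))) T =
  - pairing psi (form (fun a => l (succ a b)) (dia y z)) T -
  pairing psi (form (fun a => l (prec b a)) (dia z y + dia y z)) T.
Proof.
move=> ll; rewrite -pairing_flip //; last first.
  by apply: (continuous_form_map (F := mul^~ _)); [exact: form_c|exact: mull_c].
rewrite pairing_mulll // !pairing_flip //; exact: form_c.
Qed.
End Slots.

(** * Reduction of the compatibility conditions to pure tensors *)

Section Compatibility.
Variables (phi psi : dsum L -> K).
Hypotheses (phi_c : continuous_form phi) (psi_c : continuous_form psi).
Local Notation N phi psi u := (pairing phi psi (delta u)).

(* R1 and R2 are the two compatibility conditions paired with (phi, psi). *)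
Let R1 a b : K :=
  N phi psi (mul a b) - N psi phi (mul a b)
  - N (fun u => phi (mul a u)) psi b + N psi (fun u => phi (mul a u)) b
  - N phi (fun u => psi (mul a u)) b + N (fun u => psi (mul a u)) phi b
  - N phi (fun u => psi (mul u b)) a + N psi (fun u => phi (mul u b)) a.

Let R2 a b : K :=
  N phi psi (mul a b) - N phi psi (mul b a)
  - N phi (fun u => psi (mul u b)) a + N phi (fun u => psi (mul b u)) a
  - N phi (fun u => psi (mul a u)) b + N phi (fun u => psi (mul u a)) b
  - N (fun u => phi (mul a u)) psi b + N (fun u => phi (mul b u)) psi a.

Lemma scalar_delta (f g : dsum L -> K) (F : dsum L -> dsum L) :
  continuous_form f -> continuous_form g -> linear F -> scalar (fun u => N f g (F u)).
Proof. by move=> fc gc Fl c u v; rewrite Fl delta_linear pairing_scalar. Qed.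

Lemma scalar_pairing_mulrl (f g : dsum L -> K) T : continuous_form f -> continuous_form g ->
  scalar (fun s => pairing (fun u => f (mul s u)) g T).
Proof.
by move=> fc gc c s t; apply: pairing_mapl => // v; exact: tensor_mul_linearl.
Qed.

Lemma scalar_pairing_mulll (f g : dsum L -> K) T : continuous_form f -> continuous_form g ->
  scalar (fun s => pairing (fun u => f (mul u s)) g T).
Proof.
move=> fc gc c s t; apply: (pairing_mapl (F := mul^~ _) (G := mul^~ s) (H := mul^~ t)) => // v.
exact: tensor_mul_linearr.
Qed.

Lemma scalar_pairing_mulrr (f g : dsum L -> K) T : continuous_form f -> continuous_form g ->
  scalar (fun s => pairing f (fun u => g (mul s u)) T).
Proof.
by move=> fc gc c s t; apply: pairing_mapr => // v; exact: tensor_mul_linearl.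
Qed.

Lemma scalar_pairing_mullr (f g : dsum L -> K) T : continuous_form f -> continuous_form g ->
  scalar (fun s => pairing f (fun u => g (mul u s)) T).
Proof.
move=> fc gc c s t; apply: (pairing_mapr (F := mul^~ _) (G := mul^~ s) (H := mul^~ t)) => // v.
exact: tensor_mul_linearr.
Qed.

Let cr (f : dsum L -> K) s : continuous_form f -> continuous_form (fun u => f (mul s u)).
Proof. by move=> h; apply: (continuous_form_map h). Qed.
Let cl (f : dsum L -> K) s : continuous_form f -> continuous_form (fun u => f (mul u s)).
Proof. by move=> h; apply: (continuous_form_map (F := mul^~ s) h). Qed.

Let mulr_l s := (mulr_c s).1.
Let mull_l s := (mull_c s).1.

Lemma scalar_delta_id (f g : dsum L -> K) :
  continuous_form f -> continuous_form g -> scalar (fun u => N f g u).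
Proof. by move=> fc gc; exact: (scalar_delta (F := id)). Qed.

Ltac cont_tac := lazymatch goal with
  | |- continuous_form (fun u => ?f (tensor_mul _ _ _ u ?s)) => apply: (@cl f s); assumption
  | |- continuous_form (fun u => ?f (tensor_mul _ _ _ ?s u)) => apply: (@cr f s); assumption
  | |- _ => assumption
  end.

(* The arguments are given explicitly because unification would unfold glift. *)
Ltac slot_tac := scalar_tac; lazymatch goal with
  | |- _ (fun u => pairing ?f ?g (tensor_comul _ _ _ (tensor_mul _ _ _ ?a u))) =>
      apply: (@scalar_delta f g (mul a) _ _ (mulr_l a)); assumption
  | |- _ (fun u => pairing ?f ?g (tensor_comul _ _ _ (tensor_mul _ _ _ u ?a))) =>
      apply: (@scalar_delta f g (mul^~ a) _ _ (mull_l a)); assumption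
  | |- _ (fun u => pairing ?f ?g (tensor_comul _ _ _ u)) =>
      apply: (@scalar_delta_id f g); cont_tac
  | |- _ (fun u => pairing (fun v => ?f (tensor_mul _ _ _ u v)) ?g ?T) =>
      apply: (@scalar_pairing_mulrl f g T); assumption
  | |- _ (fun u => pairing (fun v => ?f (tensor_mul _ _ _ v u)) ?g ?T) =>
      apply: (@scalar_pairing_mulll f g T); assumption
  | |- _ (fun u => pairing ?f (fun v => ?g (tensor_mul _ _ _ u v)) ?T) =>
      apply: (@scalar_pairing_mulrr f g T); assumption
  | |- _ (fun u => pairing ?f (fun v => ?g (tensor_mul _ _ _ v u)) ?T) =>
      apply: (@scalar_pairing_mullr f g T); assumption
  end.

Lemma compat_ext :
  (forall a x b y, R1 (gpure a x) (gpure b y) = 0) ->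
  (forall a x b y, R2 (gpure a x) (gpure b y) = 0) ->
  forall a b, R1 a b = 0 /\ R2 a b = 0.
Proof.
move=> h1 h2 a b; split.
- move: a; apply: form_eq0 => [|a x]; first by rewrite /R1; slot_tac.
  move: b; apply: form_eq0 => [|b y]; first by rewrite /R1; slot_tac.
  exact: h1.
move: a; apply: form_eq0 => [|a x]; first by rewrite /R2; slot_tac.
move: b; apply: form_eq0 => [|b y]; first by rewrite /R2; slot_tac.
exact: h2.
Qed.
End Compatibility.

Local Notation N phi psi u := (pairing phi psi (delta u)).

(** * The terms of the compatibility conditions on pure tensors *)

Section Terms.
Variables (l m : A -> K) (p q : dsum B) (a b : A) (x y : dsum B).
Hypotheses (ll : scalar l) (ml : scalar m).

Lemma pairing_delta_mul : N (form l p) (form m q) (mul (gpure a x) (gpure b y)) =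
  - omega (dia x y) (dia p q) * ev2 l m (Ds (succ a b))
  + omega (dia x y) (dia q p) * ev2 m l (Dp (succ a b))
  + omega (dia y x) (dia p q) * ev2 l m (Ds (prec b a))
  - omega (dia y x) (dia q p) * ev2 m l (Dp (prec b a)).
Proof.
rewrite gpure_mul (formB (scalar_delta_id (form_c _ _) (form_c _ _))).
by rewrite !pairing_delta //; ring.
Qed.

Lemma pairing_delta_mulrl : N (fun u => form l p (mul (gpure a x) u)) (form m q) (gpure b y) =
  - omega y (dia (dia x p + dia p x) q) * ev2 (fun u => l (succ a u)) m (Ds b)
  + omega y (dia q (dia x p + dia p x)) * ev2 m (fun u => l (succ a u)) (Dp b)
  - omega y (dia (dia p x) q) * ev2 (fun u => l (prec u a)) m (Ds b)
  + omega y (dia q (dia p x)) * ev2 m (fun u => l (prec u a)) (Dp b).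
Proof.
rewrite (pairing_mulrl (form_c m q) _ _ _ _ ll).
by rewrite !pairing_delta; try form_tac; ring.
Qed.

Lemma pairing_delta_mulrr : N (form m q) (fun u => form l p (mul (gpure a x) u)) (gpure b y) =
  - omega y (dia q (dia x p + dia p x)) * ev2 m (fun u => l (succ a u)) (Ds b)
  + omega y (dia (dia x p + dia p x) q) * ev2 (fun u => l (succ a u)) m (Dp b)
  - omega y (dia q (dia p x)) * ev2 m (fun u => l (prec u a)) (Ds b)
  + omega y (dia (dia p x) q) * ev2 (fun u => l (prec u a)) m (Dp b).
Proof.
rewrite (pairing_mulrr (form_c m q) _ _ _ _ ll).
by rewrite !pairing_delta; try form_tac; ring.
Qed.

Lemma pairing_delta_mullr : N (form m q) (fun u => form l p (mul u (gpure a x))) (gpure b y) =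
  omega y (dia q (dia p x)) * ev2 m (fun u => l (succ u a)) (Ds b)
  - omega y (dia (dia p x) q) * ev2 (fun u => l (succ u a)) m (Dp b)
  + omega y (dia q (dia x p + dia p x)) * ev2 m (fun u => l (prec a u)) (Ds b)
  - omega y (dia (dia x p + dia p x) q) * ev2 (fun u => l (prec a u)) m (Dp b).
Proof.
rewrite (pairing_mullr (form_c m q) _ _ _ _ ll).
by rewrite !pairing_delta; try form_tac; ring.
Qed.
End Terms.

Section Generators.
Variables (l m : A -> K) (p q : dsum B) (a b : A) (x y : dsum B).
Hypotheses (ll : scalar l) (ml : scalar m).

Let omL := omega_mulx hB.
Let omR := omega_mulr hB.

Let bracket u v w : dia u (dia v w) = dia (dia u v) w + dia (dia v u) w.
Proof. exact: (qz_zinbiel hB). Qed.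

(* Moves x to the left argument of omega and everything else to the right. *)
Let omega_simp := (diaDl, diaDr, (fun z => formD (omegar hB z)), qz_skew hB y,
  (fun z => formD (omegal hB z)),
  omL (dia x p), omL (dia p x), omL (dia x q), omL (dia q x),
  omR (dia x p), omR (dia p x), omR (dia x q), omR (dia q x),
  omL x, omR x).

(** Both conditions have this sign pattern. Supplying the eight values as equations avoids searching
    for the terms in the goal. *)
Let signs8 (t1 t2 t3 t4 t5 t6 t7 t8 e1 e2 e3 e4 e5 e6 e7 e8 : K) :
  t1 = e1 -> t2 = e2 -> t3 = e3 -> t4 = e4 -> t5 = e5 -> t6 = e6 -> t7 = e7 -> t8 = e8 ->
  e1 - e2 - e3 + e4 - e5 + e6 - e7 + e8 = 0 -> t1 - t2 - t3 + t4 - t5 + t6 - t7 + t8 = 0.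
Proof. by move=> -> -> -> -> -> -> -> ->. Qed.

(** The expression is antisymmetric under exchanging (l, p) with (m, q). Accordingly the
    coefficients of (q p) y, (y q) p and (q y) p are those of (p q) y, (y p) q and (p y) q with l
    and m exchanged and the sign reversed. *)
Lemma compat1_gpure :
  let phi := form l p in let psi := form m q in
  let a' := gpure a x in let b' := gpure b y in
  N phi psi (mul a' b') - N psi phi (mul a' b')
  - N (fun u => phi (mul a' u)) psi b' + N psi (fun u => phi (mul a' u)) b'
  - N phi (fun u => psi (mul a' u)) b' + N (fun u => psi (mul a' u)) phi b'
  - N phi (fun u => psi (mul u b')) a' + N psi (fun u => phi (mul u b')) a' = 0.
Proof.
apply: (signs8 (pairing_delta_mul p q a b x y ll ml) (pairing_delta_mul q p a b x y ml ll)
  (pairing_delta_mulrl p q a b x y ll ml) (pairing_delta_mulrr p q a b x y ll ml)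
  (pairing_delta_mulrr q p a b x y ml ll) (pairing_delta_mulrl q p a b x y ml ll)
  (pairing_delta_mullr q p b a y x ml ll) (pairing_delta_mullr p q b a y x ll ml)).
(* From here every value of omega has the form omega x ((u v) w), with u, v, w a permutation of p,
   q, y. *)
rewrite !omega_simp !bracket !omega_simp.
have H1 := contract_odot; have H2 := contract_succ; have H3 := contract_mixed.
(* The six words (y1 y2) y3 form a basis of the multilinear part of the free     *)
(* Zinbiel algebra on p, q, y; their coefficients combine bialgebra axioms       *)
(* (1)-(3), substituted for the 0's from left to right.                          *)
transitivity (omega x (dia (dia p q) y) * 0 - omega x (dia (dia q p) y) * 0
  + omega x (dia (dia y p) q) * (0 - 0 - 0 + 0) + omega x (dia (dia p y) q) * (0 - 0 - 0)
  + omega x (dia (dia y q) p) * (- 0 + 0 - 0 + 0)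
  + omega x (dia (dia q y) p) * (- 0 + 0 + 0)); last by ring.
rewrite -{1}(H1 l m a b ll ml) -{1}(H1 m l a b ml ll).
rewrite -{1}(H1 l m a b ll ml) -{1}(H2 l m a b ll ml) -{1}(H3 l m a b ll ml) -{1}(H3 m l a b ml ll).
rewrite -{1}(H1 l m a b ll ml) -{1}(H2 l m a b ll ml) -{1}(H3 l m a b ll ml).
rewrite -{1}(H1 m l a b ml ll) -{1}(H2 m l a b ml ll) -{1}(H3 l m a b ll ml) -{1}(H3 m l a b ml ll).
rewrite -{1}(H1 m l a b ml ll) -{1}(H2 m l a b ml ll) -{1}(H3 m l a b ml ll).
ring.
Qed.

(** This expression is antisymmetric in (a, x) and (b, y). Keeping x as first argument of omega
    hides that symmetry, and the axioms enter both at (a, b) and at (b, a). *)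
Lemma compat2_gpure :
  let phi := form l p in let psi := form m q in
  let a' := gpure a x in let b' := gpure b y in
  N phi psi (mul a' b') - N phi psi (mul b' a')
  - N phi (fun u => psi (mul u b')) a' + N phi (fun u => psi (mul b' u)) a'
  - N phi (fun u => psi (mul a' u)) b' + N phi (fun u => psi (mul u a')) b'
  - N (fun u => phi (mul a' u)) psi b' + N (fun u => phi (mul b' u)) psi a' = 0.
Proof.
apply: (signs8 (pairing_delta_mul p q a b x y ll ml) (pairing_delta_mul p q b a y x ll ml)
  (pairing_delta_mullr q p b a y x ml ll) (pairing_delta_mulrr q p b a y x ml ll)
  (pairing_delta_mulrr q p a b x y ml ll) (pairing_delta_mullr q p a b x y ml ll)
  (pairing_delta_mulrl p q a b x y ll ml) (pairing_delta_mulrl p q b a y x ll ml)).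
rewrite !omega_simp !bracket !omega_simp.
have H4 := contract_Dodot_circ; have H5 := contract_Dsucc_circ.
have H6 := contract_mixed_circ.
(* As in compat1_gpure, now with the axioms (4)-(6). *)
transitivity (omega x (dia (dia p q) y) * (0 + 0)
  + omega x (dia (dia q p) y) * (- 0 - 0 + 0 + 0)
  + omega x (dia (dia y p) q) * (0 - 0) + omega x (dia (dia p y) q) * 0
  + omega x (dia (dia y q) p) * (- 0 + 0 - 0)
  + omega x (dia (dia q y) p) * (- 0 + 0 + 0 - 0)); last by ring.
rewrite -{1}(H5 l m a b ll ml) -{1}(H5 l m b a ll ml).
rewrite -{1}(H4 l m a b ll ml) -{1}(H4 l m b a ll ml) -{1}(H5 l m a b ll ml) -{1}(H5 l m b a ll ml).
rewrite -{1}(H5 l m b a ll ml) -{1}(H6 l m b a ll ml) -{1}(H5 l m b a ll ml).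
rewrite -{1}(H4 l m b a ll ml) -{1}(H5 l m b a ll ml) -{1}(H6 l m b a ll ml).
rewrite -{1}(H4 l m b a ll ml) -{1}(H5 l m b a ll ml) -{1}(H6 l m a b ll ml) -{1}(H6 l m b a ll ml).
ring.
Qed.
End Generators.

Let pairing_scalar_form l m p q : scalar (pairing (form l p) (form m q)) :=
  pairing_scalar (form_c l p) (form_c m q).

Let pairing_alt (phi psi : dsum L -> K) u : continuous_form phi -> continuous_form psi ->
  pairing phi psi (delta u - cflip (delta u)) = N phi psi u - N psi phi u.
Proof.
move=> phic psic; rewrite (formB (pairing_scalar phic psic)).
by rewrite (pairing_flip (delta u) phic psic).
Qed.

Let pairing_subr (phi psi : dsum L -> K) (F G : dsum L -> dsum L) T :
  continuous_form phi -> continuous_form psi -> continuous_map F -> continuous_map G ->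
  pairing phi (fun u => psi (F u - G u)) T =
  pairing phi (fun u => psi (F u)) T - pairing phi (fun u => psi (G u)) T.
Proof.
move=> phic psic Fc Gc.
rewrite (@pairing_mapr _ _ _ _ (-1) phi psi (fun u => F u - G u) G F T) // => [|u].
  by rewrite mulN1r addrC.
by rewrite scaleN1r addrC.
Qed.

(** Each condition has five tensor terms, and the first three give two scalars each: by
    antisymmetrization of delta in the first condition, by a commutator in the second. This accounts
    for the eight scalars. *)
Let form_combination (T : lmodType K) (f : T -> K) (t1 t2 t3 t4 t5 : T)
    (n1 n2 n3 n4 n5 n6 n7 n8 : K) : scalar f ->
  f t1 = n1 - n2 -> f t2 = n3 - n4 -> f t3 = n5 - n6 -> f t4 = n7 -> f t5 = n8 ->
  n1 - n2 - n3 + n4 - n5 + n6 - n7 + n8 = 0 -> f (t1 - t2 - t3 - t4 + t5) = 0.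
Proof.
move=> fl e1 e2 e3 e4 e5 <-.
by rewrite (formD fl) !(formB fl) e1 e2 e3 e4 e5; ring.
Qed.

Lemma tensor_bialgebra : completed_prelie_bialgebra mul delta.
Proof.
have compat l m p q a b (ll : scalar l) (ml : scalar m) :=
  compat_ext (form_c l p) (form_c m q)
    (fun a' x b' y => compat1_gpure p q a' b' x y ll ml)
    (fun a' x b' y => compat2_gpure p q a' b' x y ll ml) a b.
have sub_c F G (Fc : continuous_map F) (Gc : continuous_map G) :=
  @continuous_map_sub K L L F G Fc Gc.
split.
- exact: (tensor_prelie succ_bl prec_bl dia_bl (ldb_algebra hA) (qz_zinbiel hB)).
- exact: tensor_coalgebra.
- move=> alt a b; split; [exact: (cmapl_def_lf _ (mulr_c a).2)
    |exact: (cmapr_def_lf _ (mulr_c a).2)|exact: (cmapr_def_lf _ (mull_c b).2)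
    |exact: (cmapl_def_lf _ (mull_c b).2)].
- move=> alt a b; apply: (ctens2_eq0 hB) => l m p q ll ml.
  have [R1 _] := compat l m p q a b ll ml.
  have [[phic psic] [[ra la] [rb lb]]] := ((form_c l p, form_c m q), (mulr_c a, mull_c b)).
  have phia := continuous_form_map phic (mulr_c a).
  have psia := continuous_form_map psic (mulr_c a).
  have phib := continuous_form_map phic (mull_c b).
  apply: (form_combination (pairing_scalar_form l m p q) _ _ _ _ _ R1).
  + exact: pairing_alt.
  + exact: (etrans (pairing_cmapl _ phic psic ra la) (pairing_alt b phia psic)).
  + exact: (etrans (pairing_cmapr _ phic psic ra la) (pairing_alt b phic psia)).
  + exact: (pairing_cmapr _ phic psic rb lb).
  + exact: (etrans (pairing_cmapl _ phic psic rb lb) (pairing_flip _ phib psic)).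
- move=> a b; split; [exact: (cmapr_def_lf _ (sub_c _ _ (mull_c b) (mulr_c b)).2)
    |exact: (cmapr_def_lf _ (sub_c _ _ (mulr_c a) (mull_c a)).2)
    |exact: (cmapl_def_lf _ (mulr_c a).2)|exact: (cmapl_def_lf _ (mulr_c b).2)].
- move=> a b; apply: (ctens2_eq0 hB) => l m p q ll ml.
  have [_ R2] := compat l m p q a b ll ml.
  have [phic psic] := (form_c l p, form_c m q).
  have [cb cb'] := sub_c _ _ (mull_c b) (mulr_c b).
  have [ca ca'] := sub_c _ _ (mulr_c a) (mull_c a).
  apply: (form_combination (pairing_scalar_form l m p q) _ _ _ _ _ R2).
  + exact: (formB (scalar_delta_id phic psic)).
  + apply: etrans (pairing_cmapr _ phic psic cb cb') _.
    exact: (pairing_subr _ phic psic (mull_c b) (mulr_c b)).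
  + apply: etrans (pairing_cmapr _ phic psic ca ca') _.
    exact: (pairing_subr _ phic psic (mulr_c a) (mull_c a)).
  + exact: (pairing_cmapl _ phic psic (mulr_c a).1 (mulr_c a).2).
  + exact: (pairing_cmapl _ phic psic (mulr_c b).1 (mulr_c b).2).
Qed.
End Contraction.

Theorem theorem2p21 (K : fieldType)
    (A : vectType K) (succ prec : A -> A -> A) (Ds Dp : A -> tens A A)
    (hA : leibniz_dendriform_bialgebra succ prec Ds Dp)
    (B : int -> vectType K) (dia : dsum B -> dsum B -> dsum B)
    (omega : dsum B -> dsum B -> K) (hB : quadratic_graded_zinbiel dia omega)
    (eta : dsum B -> ctens2 B B) (eta_linear : linear eta)
    (eta_omega : forall b1 b2 b3 : dsum B,
       omega_hat omega (eta b1) b2 b3 = - omega b1 (dia b2 b3)) :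
  completed_prelie_bialgebra (tensor_mul succ prec dia) (tensor_comul Ds Dp eta).
Proof. exact: (tensor_bialgebra hA hB eta_linear eta_omega). Qed.
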